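(* Let $\Lambda$ be a virtually Gorenstein Artin algebra and let $M$ be a (not necessarily finitely generated) right $\Lambda$-module. If $\mathrm{Ext}^n_\Lambda(M,\Lambda)=0$ for all $n\ge 0$, then $M=0$.
   Context: All modules are unitary right modules. A $\Lambda$-module $M$ is Gorenstein projective if there is an exact sequence $\cdots\to P_1\to P_0\to P_{-1}\to P_{-2}\to\cdots$ of projective $\Lambda$-modules that stays exact under $\mathrm{Hom}_\Lambda(-,Q)$ for every projective $\Lambda$-module $Q$, with $M=\mathrm{im}(P_0\to P_{-1})$. Dually, $M$ is Gorenstein injective if there is an exact sequence $\cdots\to I_1\to I_0\to I_{-1}\to I_{-2}\to\cdots$ of injective $\Lambda$-modules that stays exact under $\mathrm{Hom}_\Lambda(Q,-)$ for every injective $\Lambda$-module $Q$, with $M=\mathrm{im}(I_0\to I_{-1})$. $\mathscr{GP}$ and $\mathscr{GI}$ denote the classes of all (not necessarily finitely generated) Gorenstein projective and Gorenstein injective right $\Lambda$-modules. For a class $\mathscr C$ of modules, $\mathscr C^{\perp}=\{X:\mathrm{Ext}^1_\Lambda(C,X)=0\ \forall C\in\mathscr C\}$ and ${}^{\perp}\mathscr C=\{X:\mathrm{Ext}^1_\Lambda(X,C)=0\ \forall C\in\mathscr C\}$. An Artin algebra $\Lambda$ is virtually Gorenstein if $\mathscr{GP}^{\perp}={}^{\perp}\mathscr{GI}$. Here $\mathrm{Ext}^0_\Lambda=\mathrm{Hom}_\Lambda$. *)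

(* Defs.v *)
From HB Require Import structures.
From mathcomp Require Import all_boot all_order all_algebra.

Set Implicit Arguments.
Unset Strict Implicit.
Unset Printing Implicit Defensive.

Import GRing.Theory.

Local Open Scope ring_scope.

(* All notions are stated for left R-modules ([lmodType R]). Right modules    *)
(* over a ring A are the left modules over the converse ring A^c, so that     *)
(* [a *: m] with [a : A^c] is the right action m a; in particular [A^c^o] is  *)
(* A regarded as a right module over itself.                                  *)

Section Homological.
Variable R : pzRingType.
Implicit Types M N P Q I X Y Z : lmodType R.

Definition surjective_map (T U : Type) (f : T -> U) : Prop :=
  forall y, exists x, f x = y.

Definition projective P : Prop :=
  forall X Y (g : {linear X -> Y}) (f : {linear P -> Y}),
    surjective_map g -> exists h : {linear P -> X}, g \o h =1 f.

Definition injective_module I : Prop :=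
  forall X Y (g : {linear X -> Y}) (f : {linear X -> I}),
    injective g -> exists h : {linear Y -> I}, h \o g =1 f.

(* Exactness of  X --f--> Y --g--> Z  at Y.                                   *)
Definition exact_at X Y Z (f : {linear X -> Y}) (g : {linear Y -> Z}) : Prop :=
  forall y, g y = 0 <-> exists x, f x = y.

(* Exactness of  Hom(Z,N) -> Hom(Y,N) -> Hom(X,N)  at Hom(Y,N).               *)
Definition hom_to_exact_at X Y Z (f : {linear X -> Y}) (g : {linear Y -> Z}) N
    : Prop :=
  forall u : {linear Y -> N},
    (forall x, u (f x) = 0) <-> exists v : {linear Z -> N}, u =1 v \o g.

(* Exactness of  Hom(N,X) -> Hom(N,Y) -> Hom(N,Z)  at Hom(N,Y).               *)
Definition hom_from_exact_at X Y Z (f : {linear X -> Y}) (g : {linear Y -> Z}) N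
    : Prop :=
  forall u : {linear N -> Y},
    (forall x, g (u x) = 0) <-> exists v : {linear N -> X}, u =1 f \o v.

Record proj_resolution M := ProjResolution {
  res_obj : nat -> lmodType R;
  res_diff : forall n, {linear res_obj n.+1 -> res_obj n};
  res_aug : {linear res_obj 0 -> M};
  res_projective : forall n, projective (res_obj n);
  res_aug_surj : surjective_map res_aug;
  res_aug_exact : exact_at (res_diff 0) res_aug;
  res_exact : forall n, exact_at (res_diff n.+1) (res_diff n)
}.

(* Ext^n(M,N) = 0. In degree 0, Ext is Hom; in degree n+1, the cohomology of  *)
(* Hom(P,N) at Hom(P_{n+1},N) vanishes for a projective resolution P of M.    *)
(* As usual this does not depend on the choice of P.                          *)
Definition ext_vanishes (n : nat) M N : Prop :=
  match n with
  | 0 => forall (f : {linear M -> N}) x, f x = 0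
  | m.+1 => exists P : proj_resolution M,
      hom_to_exact_at (res_diff P m.+1) (res_diff P m) N
  end.

Definition is_image_of X Y (f : {linear X -> Y}) M : Prop :=
  exists iota : {linear M -> Y},
    injective iota /\
    forall y, (exists m, iota m = y) <-> (exists x, f x = y).

(* The complexes are indexed so that d i : P_{i+1} -> P_i; hence d (-1) is    *)
(* the map P_0 -> P_{-1}.                                                     *)
Definition gorenstein_projective M : Prop :=
  exists (P : int -> lmodType R) (d : forall i : int, {linear P (i + 1) -> P i}),
    [/\ forall i, projective (P i),
        forall i, exact_at (d (i + 1)) (d i),
        forall Q, projective Q -> forall i, hom_to_exact_at (d (i + 1)) (d i) Q
      & is_image_of (d (-1)) M].

Definition gorenstein_injective M : Prop :=
  exists (I : int -> lmodType R) (d : forall i : int, {linear I (i + 1) -> I i}),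
    [/\ forall i, injective_module (I i),
        forall i, exact_at (d (i + 1)) (d i),
        forall Q, injective_module Q ->
          forall i, hom_from_exact_at (d (i + 1)) (d i) Q
      & is_image_of (d (-1)) M].

Definition right_perp (C : lmodType R -> Prop) X : Prop :=
  forall Y, C Y -> ext_vanishes 1 Y X.

Definition left_perp (C : lmodType R -> Prop) X : Prop :=
  forall Y, C Y -> ext_vanishes 1 X Y.

End Homological.

Definition artinian (k : comPzRingType) : Prop :=
  forall J : nat -> {pred k^o},
    (forall n, submod_closed (J n)) ->
    (forall n, {subset J n.+1 <= J n}) ->
    exists N, forall n, (N <= n)%N -> J n =i J N.

Definition finitely_generated (k : pzRingType) (V : lmodType k) : Prop :=
  exists (m : nat) (b : 'I_m -> V),
    forall v, exists c : 'I_m -> k, v = \sum_(i < m) c i *: b i.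

Definition artin_algebra (k : comPzRingType) (A : algType k) : Prop :=
  artinian k /\ finitely_generated A.

Definition virtually_gorenstein (A : pzRingType) : Prop :=
  forall X : lmodType A^c,
    right_perp (@gorenstein_projective A^c) X <->
    left_perp (@gorenstein_injective A^c) X.

(* Main.v *)
Require Import Defs.
From HB Require Import structures.
From mathcomp Require Import all_boot all_order all_algebra.
From mathcomp Require Import boolp.
From mathcomp Require classical_sets.

Set Implicit Arguments.
Unset Strict Implicit.
Unset Printing Implicit Defensive.

Import GRing.Theory.
Local Open Scope ring_scope.

(** Write R for the converse ring of A, so that R-modules are right A-modules,
    and D for Hom_k (-, E), where E is an injective k-module.  Let P be a
    projective resolution of M.  By hypothesis the complex Hom_R (P, R) is exact,
    in degree 0 included, so its dual Y_n = D Hom_R (P_n, R) is an exact complex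
    ... -> Y_1 -> Y_0 -> 0 of right A-modules.  For F finitely generated there is
    a natural isomorphism Hom_R (F, Y_n) = D Hom_R (P_n, F) ([hom_dual_inj],
    [hom_dual_surj]).  It shows that each Y_n is injective ([dualm_injective]),
    that Hom_R (F, Y) is exact in positive degrees when F is moreover injective
    ([dual_diff_fg_exact]), and that D Hom_R (M, F) = 0 as soon as the map
    Y_1 -> Y_0 splits ([dual_split_hom0]).  Finitely generated injectives
    cogenerate, over k and over R ([fg_injective_cogenerator] and
    [fg_injective_cogenerator_alg]), so M = 0 once Y_1 -> Y_0 splits for all E.

    The splitting comes from virtual Gorensteinness through a periodic module.
    Let V be the product of the Y_n modulo their direct sum, with the
    endomorphism dV that applies Y_(n+1) -> Y_n componentwise.  Modulo finite
    support the low degrees disappear, so the complex with V in every degree and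
    differential dV is exact ([dV_exact]).  V is injective, and Hom_R (I, -) keeps
    the complex exact for I injective: this is clear for I finitely generated, and
    every injective is a summand of a direct sum of finitely generated ones
    ([embed_dsum]).  Hence Q = ker dV is Gorenstein injective ([Q_gi]).

    Let Z_n be the cycles of Y, so that Q is the product of the Z_n modulo their
    direct sum.  The exact sequence 0 -> Z_n -> Y_n -> ... -> Y_0 -> 0 shows that
    Z_n has finite injective dimension, hence is right orthogonal to the
    Gorenstein projectives and left orthogonal to the Gorenstein injectives.  The
    first property passes to products and the second to direct sums.  Virtual
    Gorensteinness turns the first into the second for the product of the Z_n;
    as left orthogonality also passes to cokernels of monomorphisms, Q is left
    orthogonal to Q itself, and the inclusion of Q in V lifts along dV ([Q_lift]).

    For a left ideal K of R, which is finitely generated, the lift shows that for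
    large n every map from K to Z_n extends to R ([ideal_extends]).  There are only
    finitely many simple modules up to isomorphism, and one ideal K for each of them
    suffices in Baer's criterion ([finitely_many_simples], [baer]).  Hence some Z_n is
    injective, and Y splits from degree n down to degree 0. *)

(** * Submodules, products, direct sums and quotients *)

Section MkLin.
Variables (R : pzRingType) (U V : lmodType R) (f : U -> V).
Hypothesis f_lin : linear f.
Let g (u : U) : V := f u.
HB.instance Definition _ := GRing.isLinear.Build R U V *:%R g f_lin.

(* Opaque, so that simplification does not unfold the maps built below. *)
Lemma mklin_exists : {h : {linear U -> V} | forall x, h x = f x}.
Proof. by exists g. Qed.
Definition mklin : {linear U -> V} := sval mklin_exists.
Lemma mklinE x : mklin x = f x. Proof. exact: (svalP mklin_exists). Qed.
End MkLin.

Lemma linP (R : pzRingType) (U V : lmodType R) (f : {linear U -> V}) a u v :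
  f (a *: u + v) = a *: f u + f v.
Proof. exact: linearP. Qed.

Lemma linZ (R : pzRingType) (U V : lmodType R) (f : {linear U -> V}) a u :
  f (a *: u) = a *: f u.
Proof. exact: linearZ. Qed.

Definition submod (R : pzRingType) (V : lmodType R) (S : V -> Prop) : Prop :=
  S 0 /\ forall a u v, S u -> S v -> S (a *: u + v).

Section SubmodTheory.
Variables (R : pzRingType) (V : lmodType R).
Implicit Types S : V -> Prop.

Lemma submod0 S : submod S -> S 0. Proof. by case. Qed.

Lemma submodD S u v : submod S -> S u -> S v -> S (u + v).
Proof. by case=> _ H Su Sv; rewrite -[u]scale1r; apply: H. Qed.

Lemma submodZ S a u : submod S -> S u -> S (a *: u).
Proof. by case=> S0 H Su; rewrite -[_ *: _]addr0; apply: H. Qed.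

Lemma submodN S u : submod S -> S u -> S (- u).
Proof. by move=> Ss Su; rewrite -scaleN1r; apply: submodZ. Qed.

Lemma submodB S u v : submod S -> S u -> S v -> S (u - v).
Proof. by move=> Ss Su Sv; apply: submodD => //; apply: submodN. Qed.

Lemma submod_sum S (I : Type) (s : seq I) (F : I -> V) :
  submod S -> (forall i, S (F i)) -> S (\sum_(i <- s) F i).
Proof.
move=> Ss SF; elim/big_rec: _ => [|i x _ Sx]; first exact: submod0.
exact: submodD.
Qed.

Lemma submodT : submod (fun _ : V => True). Proof. by []. Qed.

Lemma submod00 : submod (fun v : V => v = 0).
Proof. by split=> // a u v -> ->; rewrite scaler0 addr0. Qed.

Lemma submodI S T : submod S -> submod T -> submod (fun v => S v /\ T v).
Proof.
move=> Ss Ts; split; first by split; apply: submod0.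
by move=> a u v [Su Tu] [Sv Tv]; split; apply: submodD => //; apply: submodZ.
Qed.

Lemma submodDs S T :
  submod S -> submod T -> submod (fun v => exists s t, [/\ S s, T t & v = s + t]).
Proof.
move=> Ss Ts; split.
  by exists 0, 0; rewrite addr0; split=> //; apply: submod0.
move=> a _ _ [s [t [Ss1 Tt1 ->]]] [s' [t' [Ss2 Tt2 ->]]].
exists (a *: s + s'), (a *: t + t'); split; first by apply Ss.
  by apply Ts.
by rewrite scalerDr addrACA.
Qed.

Lemma submod_cyc x : submod (fun v : V => exists c, v = c *: x).
Proof.
split; first by exists 0; rewrite scale0r.
by move=> a _ _ [c ->] [d ->]; exists (a * c + d); rewrite scalerDl scalerA.
Qed.

End SubmodTheory.

Section SubmodMap.
Variables (R : pzRingType) (U V : lmodType R) (f : {linear U -> V}).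

Lemma submod_ker : submod (fun u => f u = 0).
Proof.
split; first by rewrite linear0.
by move=> a u v fu fv; rewrite linearP fu fv scaler0 addr0.
Qed.

Lemma submod_im : submod (fun v => exists u, f u = v).
Proof.
split; first by exists 0; rewrite linear0.
by move=> a _ _ [u <-] [v <-]; exists (a *: u + v); rewrite linearP.
Qed.

Lemma submod_preim (S : V -> Prop) : submod S -> submod (fun u => S (f u)).
Proof.
move=> Ss; split; first by rewrite linear0; apply: submod0.
by move=> a u v fu fv; rewrite linearP; apply Ss.
Qed.

End SubmodMap.

Section SubType.
Variables (R : pzRingType) (V : lmodType R) (S : V -> Prop).

(** The proof is a parameter of the type, so that it can be recovered from the type
    by unification. *)
Record subm (Ss : submod S) := Subm { subm_val : V; subm_valP : `[< S subm_val >] }.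

Variable Ss : submod S.
Let P : pred V := fun v => `[< S v >].

Let P_closed : subsemimod_closed P.
Proof.
apply: GRing.submod_closed_semi; split=> [|a u v]; rewrite !unfold_in.
  by apply/asboolP; apply: submod0.
by move=> /asboolP Su /asboolP Sv; apply/asboolP; case: Ss => _ H; apply: H.
Qed.

HB.instance Definition _ := [isSub of subm Ss for @subm_val Ss].
HB.instance Definition _ := [Choice of subm Ss by <:].
HB.instance Definition _ :=
  GRing.SubChoice_isSubLmodule.Build R V P (subm Ss) P_closed.

Lemma subm_val_linear : linear (fun x : subm Ss => \val x).
Proof. by move=> a x y; rewrite linearP. Qed.
(* Not [mklin _] itself, which [mklinE] would then see through. *)
Lemma subv_exists : {f : {linear subm Ss -> V} | forall x, f x = subm_val x}.
Proof. by exists (mklin subm_val_linear) => x; rewrite mklinE. Qed.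
Definition subv : {linear subm Ss -> V} := sval subv_exists.

Let subvE x : subv x = subm_val x. Proof. exact: (svalP subv_exists). Qed.

Lemma subv_inj : injective subv.
Proof. by move=> x y; rewrite !subvE; apply: val_inj. Qed.
Lemma subvP x : S (subv x). Proof. by rewrite subvE; apply/asboolP; apply: (valP x). Qed.
Definition msub v (Sv : S v) : subm Ss := Subm Ss (asboolT Sv).
Lemma msubK v (Sv : S v) : subv (msub Sv) = v. Proof. exact: subvE. Qed.

End SubType.
Arguments subv {R V S Ss}.

Section SubLift.
Variables (R : pzRingType) (U V : lmodType R) (S : V -> Prop) (Ss : submod S).
Variables (f : {linear U -> V}) (fS : forall u, S (f u)).

Definition corestr_fun u : subm Ss := msub Ss (fS u).
Lemma corestr_linear : linear corestr_fun.
Proof. by move=> a u v; apply: subv_inj; rewrite linP !msubK linP. Qed.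
Definition corestr : {linear U -> subm Ss} := mklin corestr_linear.
Lemma corestrE u : subv (corestr u) = f u.
Proof. by rewrite /corestr mklinE /corestr_fun msubK. Qed.

End SubLift.

Section Prod.
Variables (R : pzRingType) (I : Type) (V : I -> lmodType R).

Definition prodm : Type := forall i, V i.
HB.instance Definition _ := gen_eqMixin prodm.
HB.instance Definition _ := gen_choiceMixin prodm.
Implicit Types x y z : prodm.

Lemma prodm_ext x y : (forall i, x i = y i) -> x = y.
Proof. exact: functional_extensionality_dep. Qed.

Definition prodm_zero : prodm := fun i => 0.
Definition prodm_opp x : prodm := fun i => - x i.
Definition prodm_add x y : prodm := fun i => x i + y i.
Definition prodm_scale a x : prodm := fun i => a *: x i.

Fact prodm_addA : associative prodm_add.
Proof. by move=> x y z; apply: prodm_ext => i; apply: addrA. Qed.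
Fact prodm_addC : commutative prodm_add.
Proof. by move=> x y; apply: prodm_ext => i; apply: addrC. Qed.
Fact prodm_add0 : left_id prodm_zero prodm_add.
Proof. by move=> x; apply: prodm_ext => i; apply: add0r. Qed.
Fact prodm_addN : left_inverse prodm_zero prodm_opp prodm_add.
Proof. by move=> x; apply: prodm_ext => i; apply: addNr. Qed.
HB.instance Definition _ :=
  GRing.isZmodule.Build prodm prodm_addA prodm_addC prodm_add0 prodm_addN.

Fact prodm_scaleA a b x : prodm_scale a (prodm_scale b x) = prodm_scale (a * b) x.
Proof. by apply: prodm_ext => i; apply: scalerA. Qed.
Fact prodm_scale1 : left_id 1 prodm_scale.
Proof. by move=> x; apply: prodm_ext => i; apply: scale1r. Qed.
Fact prodm_scaleDr : right_distributive prodm_scale +%R.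
Proof. by move=> a x y; apply: prodm_ext => i; apply: scalerDr. Qed.
Fact prodm_scaleDl x : {morph prodm_scale^~ x : a b / a + b}.
Proof. by move=> a b; apply: prodm_ext => i; apply: scalerDl. Qed.
HB.instance Definition _ := GRing.Zmodule_isLmodule.Build R prodm
  prodm_scaleA prodm_scale1 prodm_scaleDr prodm_scaleDl.

Lemma prodmD x y i : (x + y) i = x i + y i. Proof. by []. Qed.
Lemma prodmN x i : (- x) i = - x i. Proof. by []. Qed.
Lemma prodmZ a x i : (a *: x) i = a *: x i. Proof. by []. Qed.
Lemma prodm0 i : (0 : prodm) i = 0. Proof. by []. Qed.

Definition pr_fun i x : V i := x i.
Lemma pr_linear i : linear (pr_fun i). Proof. by []. Qed.
Definition pr i : {linear prodm -> V i} := mklin (@pr_linear i).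
Lemma prE i x : pr i x = x i. Proof. exact: mklinE. Qed.

Definition tuplem_fun (U : lmodType R) (f : forall i, {linear U -> V i}) u : prodm :=
  fun i => f i u.
Lemma tuplem_linear (U : lmodType R) (f : forall i, {linear U -> V i}) : linear (@tuplem_fun U f).
Proof. by move=> a u v; apply: prodm_ext => i; apply: linearP. Qed.
Definition tuplem (U : lmodType R) (f : forall i, {linear U -> V i}) :
  {linear U -> prodm} := mklin (@tuplem_linear U f).
Lemma tuplemE (U : lmodType R) (f : forall i, {linear U -> V i}) u i :
  tuplem f u i = f i u.
Proof. by rewrite /tuplem mklinE. Qed.

End Prod.

Lemma linear_inj0 (R : pzRingType) (U V : lmodType R) (f : {linear U -> V}) :
  (forall u, f u = 0 -> u = 0) -> injective f.
Proof. by move=> H u v e; apply/subr0_eq/H; rewrite linearB e subrr. Qed.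

Section Factor.
Variable R : pzRingType.
Implicit Types U V W I J P : lmodType R.

Lemma factor_surj U V W (p : {linear U -> V}) (f : {linear U -> W}) :
  surjective_map p -> (forall u, p u = 0 -> f u = 0) ->
  exists g : {linear V -> W}, forall u, g (p u) = f u.
Proof.
move=> ps kf; pose s v := sval (cid (ps v)).
have sK v : p (s v) = v by apply: (svalP (cid (ps v))).
have fe u u' : p u = p u' -> f u = f u'.
  by move=> e; apply/subr0_eq; rewrite -linearB; apply: kf; rewrite linearB e subrr.
have gl : linear (fun v => f (s v)).
  by move=> a u v /=; rewrite -linearP; apply: fe; rewrite linearP !sK.
by exists (mklin gl) => u; rewrite mklinE; apply: fe; rewrite sK.
Qed.

Lemma factor_inj U V W (i : {linear U -> V}) (f : {linear W -> V}) :
  injective i -> (forall w, exists u, i u = f w) ->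
  exists g : {linear W -> U}, forall w, i (g w) = f w.
Proof.
move=> ii fi; pose g w := sval (cid (fi w)).
have gK w : i (g w) = f w by apply: (svalP (cid (fi w))).
have gl : linear g by move=> a u v; apply: ii; rewrite linearP !gK linearP.
by exists (mklin gl) => w; rewrite mklinE gK.
Qed.

(** The extension property of injectives along maps that need not be injective. *)
Lemma inj_factor U V I (a : {linear U -> V}) (f : {linear U -> I}) :
  injective_module I -> (forall u, a u = 0 -> f u = 0) ->
  exists g : {linear V -> I}, forall u, g (a u) = f u.
Proof.
move=> injI kf; pose Ss := submod_im a.
have aS u : exists v, a v = a u by exists u.
pose p := corestr Ss aS.
have [|u pu0|g gp] := @factor_surj _ _ _ p f.
- move=> v; have [u e] := subvP v; by exists u; apply: subv_inj; rewrite corestrE.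
- by apply: kf; rewrite -(corestrE Ss aS) -/p pu0 linear0.
have [h hg] := injI _ _ (subv (S := _) (Ss := Ss)) g (@subv_inj _ _ _ Ss).
by exists h => u; rewrite -(corestrE Ss aS u) -(gp u); apply: (hg (p u)).
Qed.

(** The lifting property of projectives along maps that need not be onto. *)
Lemma proj_factor P U V (b : {linear U -> V}) (f : {linear P -> V}) :
  projective P -> (forall p, exists u, b u = f p) ->
  exists g : {linear P -> U}, forall p, b (g p) = f p.
Proof.
move=> projP fb; pose Ss := submod_im b.
have bS u : exists v, b v = b u by exists u.
pose p := corestr Ss bS; pose q := corestr Ss fb.
have [|g gp] := projP _ _ p q.
  move=> v; have [u e] := subvP v; by exists u; apply: subv_inj; rewrite corestrE.
by exists g => x; have /= := congr1 (@subv _ _ _ Ss) (gp x); rewrite -/p !corestrE.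
Qed.

Lemma injective_retract I J (i : {linear J -> I}) (r : {linear I -> J}) :
  injective_module I -> (forall x, r (i x) = x) -> injective_module J.
Proof.
move=> injI riK X Y g f ginj.
have [h hg] := injI _ _ g (i \o f : {linear X -> I}) ginj.
by exists (r \o h : {linear Y -> J}) => x /=; rewrite -[RHS]riK; have /= <- := hg x.
Qed.

Lemma injective_prodm (I : Type) (V : I -> lmodType R) :
  (forall i, injective_module (V i)) -> injective_module (prodm V).
Proof.
move=> injV X Y g f ginj.
have H i : exists h : {linear Y -> V i}, forall x, h (g x) = f x i.
  have [h hg] := injV i _ _ g (pr V i \o f : {linear X -> V i}) ginj.
  by exists h => x; have /= -> := hg x; rewrite prE.
pose h i := sval (cid (H i)).
exists (tuplem h) => x; apply: prodm_ext => i; rewrite /= tuplemE.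
exact: (svalP (cid (H i))).
Qed.

End Factor.

Section DirectSum.
Variables (R : pzRingType) (I : choiceType) (V : I -> lmodType R).

Definition fin_supp (x : prodm V) : Prop :=
  exists s : seq I, forall i, i \notin s -> x i = 0.

Lemma submod_fin_supp : submod fin_supp.
Proof.
split; first by exists [::].
move=> a x y [s xs] [t yt]; exists (s ++ t) => i.
by rewrite mem_cat negb_or => /andP[/xs xi /yt yi]; rewrite prodmD prodmZ xi yi scaler0 addr0.
Qed.

Definition dsum := subm submod_fin_supp.

Definition inp_fun t (v : V t) : prodm V := @dfwith I V (fun=> 0) t v.
Lemma inp_linear t : linear (@inp_fun t).
Proof.
move=> a u v; apply: prodm_ext => i; rewrite prodmD prodmZ /inp_fun.
have [e|ne] := eqVneq t i; first by case: i / e; rewrite !dfwith_in.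
by rewrite !dfwith_out // scaler0 addr0.
Qed.

Lemma inp_fin_supp t v : fin_supp (mklin (@inp_linear t) v).
Proof.
by exists [:: t] => i; rewrite inE => ti; rewrite mklinE /inp_fun dfwith_out // eq_sym.
Qed.

Definition ind t : {linear V t -> dsum} := corestr submod_fin_supp (@inp_fin_supp t).

Lemma ind_in t v : subv (ind t v) t = v.
Proof. by rewrite corestrE mklinE; apply: dfwith_in. Qed.

Lemma ind_out t v i : i != t -> subv (ind t v) i = 0.
Proof. by move=> ti; rewrite corestrE mklinE; apply: dfwith_out; rewrite eq_sym. Qed.

Let supp (x : dsum) := undup (sval (cid (subvP x))).

Let supp_out x i : i \notin supp x -> subv x i = 0.
Proof. by rewrite mem_undup; apply: (svalP (cid (subvP x))). Qed.

Let big_supp (W : nmodType) (s t : seq I) (F : I -> W) :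
  uniq s -> uniq t -> {subset s <= t} -> (forall i, i \notin s -> F i = 0) ->
  \sum_(i <- t) F i = \sum_(i <- s) F i.
Proof.
move=> us ut st Fs; rewrite (bigID (mem s)) /= [X in _ + X]big1 // addr0.
rewrite -big_filter; apply/perm_big/uniq_perm => //; first exact: filter_uniq.
by move=> i; rewrite mem_filter andb_idr //; apply: st.
Qed.

Lemma dsum_sumE (x : dsum) (s : seq I) : uniq s ->
  (forall i, i \notin s -> subv x i = 0) -> x = \sum_(i <- s) ind i (subv x i).
Proof.
move=> us xs; apply: subv_inj; rewrite linear_sum; apply: prodm_ext => j.
rewrite -[RHS]prE linear_sum.
have [js|js] := boolP (j \in s).
  rewrite (bigD1_seq j) //= [X in X + _]prE ind_in big1 ?addr0 //.
  by move=> i ij; rewrite prE; apply: ind_out; rewrite eq_sym.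
rewrite xs // big_seq big1 // => i iis.
by rewrite prE; apply: ind_out; apply: contraNneq js => ->.
Qed.

Lemma dsum_lift (W : lmodType R) (f : forall i, {linear V i -> W}) :
  exists h : {linear dsum -> W}, forall i v, h (ind i v) = f i v.
Proof.
pose h x := \sum_(i <- supp x) f i (subv x i).
have hE (x : dsum) (s : seq I) : uniq s -> (forall i, i \notin s -> subv x i = 0) ->
    h x = \sum_(i <- s) f i (subv x i).
  move=> us xs; pose t := undup (s ++ supp x).
  have ut : uniq t by apply: undup_uniq.
  apply: (@etrans _ _ (\sum_(i <- t) f i (subv x i))).
    symmetry; apply: big_supp => [|//|i|i /supp_out ->]; last by rewrite linear0.
      exact: undup_uniq.
    by rewrite [i \in t]mem_undup mem_cat orbC => ->.
  apply: big_supp => // [i|i /xs ->]; last by rewrite linear0.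
  by rewrite [i \in t]mem_undup mem_cat => ->.
have hl : linear h.
  move=> a x y; pose s := undup (supp x ++ supp y).
  have us : uniq s by apply: undup_uniq.
  have sx i : i \notin s -> subv x i = 0.
    by rewrite [i \in s]mem_undup mem_cat negb_or => /andP[/supp_out].
  have sy i : i \notin s -> subv y i = 0.
    by rewrite [i \in s]mem_undup mem_cat negb_or => /andP[_ /supp_out].
  rewrite (hE _ s) // => [|i ns]; last by rewrite linP prodmD prodmZ sx ?sy // scaler0 addr0.
  rewrite (hE x s) // (hE y s) // scaler_sumr -big_split /=.
  by apply: eq_bigr => i _; rewrite linP prodmD prodmZ linP.
exists (mklin hl) => i v; rewrite mklinE (hE _ [:: i]) //.
  by rewrite big_seq1 ind_in.
by move=> j; rewrite inE => ji; apply: ind_out.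
Qed.

Lemma dsum_lin_ext (W : lmodType R) (f g : {linear dsum -> W}) :
  (forall i v, f (ind i v) = g (ind i v)) -> f =1 g.
Proof.
move=> fg x; rewrite (@dsum_sumE x (supp x)) ?undup_uniq //; last exact: supp_out.
by rewrite !linear_sum; apply: eq_bigr => i _.
Qed.

End DirectSum.

Section Quotient.
Variables (R : pzRingType) (V : lmodType R) (S : V -> Prop) (Ss : submod S).

Let rep_ex (v : V) : exists w, `[< S (w - v) >].
Proof. by exists v; rewrite subrr; apply/asboolP; apply: submod0. Qed.

Let rep v := xchoose (rep_ex v).

Let repP v : S (rep v - v).
Proof. by apply/asboolP; apply: (xchooseP (rep_ex v)). Qed.

Let rep_eq u v : S (u - v) -> rep u = rep v.
Proof.
move=> Suv; apply: eq_xchoose => w; apply: asbool_equiv_eq; split=> Sw.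
  by rewrite -(subrK u w) -addrA; apply: submodD.
by rewrite -(subrK v w) -addrA -[v - u]opprB; apply: submodB.
Qed.

Let rep_rep v : rep (rep v) == rep v.
Proof. by apply/eqP/rep_eq. Qed.

(** A coset is represented by its canonical element, which makes the quotient a
    subtype of [V]. *)
Definition quotm := {v : V | rep v == v}.
HB.instance Definition _ := [isSub for (@proj1_sig V (fun v => rep v == v) : quotm -> V)].
HB.instance Definition _ := [Choice of quotm by <:].

Let qpi (v : V) : quotm := exist _ (rep v) (rep_rep v).

Let qpi_eq u v : S (u - v) -> qpi u = qpi v.
Proof. by move=> Suv; apply: val_inj; apply: rep_eq. Qed.

Let qpi_val (x : quotm) : qpi (val x) = x.
Proof. by apply: val_inj => /=; apply/eqP; apply: (valP x). Qed.

Let qadd (x y : quotm) := qpi (val x + val y).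
Let qopp (x : quotm) := qpi (- val x).
Let qscale a (x : quotm) := qpi (a *: val x).

Let qaddE u v : qadd (qpi u) (qpi v) = qpi (u + v).
Proof. by apply: qpi_eq; rewrite opprD addrACA; apply: submodD => //; apply: repP. Qed.
Let qoppE u : qopp (qpi u) = qpi (- u).
Proof. by apply: qpi_eq; rewrite -opprD; apply: submodN => //; apply: repP. Qed.
Let qscaleE a u : qscale a (qpi u) = qpi (a *: u).
Proof. by apply: qpi_eq; rewrite -scalerBr; apply: submodZ => //; apply: repP. Qed.

Fact qaddA : associative qadd.
Proof.
by move=> x y z; rewrite -(qpi_val x) -(qpi_val y) -(qpi_val z) !qaddE addrA.
Qed.
Fact qaddC : commutative qadd.
Proof. by move=> x y; rewrite -(qpi_val x) -(qpi_val y) !qaddE addrC. Qed.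
Fact qadd0 : left_id (qpi 0) qadd.
Proof. by move=> x; rewrite -(qpi_val x) !qaddE add0r. Qed.
Fact qaddN : left_inverse (qpi 0) qopp qadd.
Proof. by move=> x; rewrite -(qpi_val x) qoppE qaddE addNr. Qed.
HB.instance Definition _ := GRing.isZmodule.Build quotm qaddA qaddC qadd0 qaddN.

Fact qscaleA a b x : qscale a (qscale b x) = qscale (a * b) x.
Proof. by rewrite -(qpi_val x) !qscaleE scalerA. Qed.
Fact qscale1 : left_id 1 qscale.
Proof. by move=> x; rewrite -(qpi_val x) qscaleE scale1r. Qed.
Fact qscaleDr : right_distributive qscale +%R.
Proof.
move=> a x y; rewrite -[x + y]/(qadd x y) -[RHS]/(qadd _ _) -(qpi_val x) -(qpi_val y).
by rewrite qaddE !qscaleE qaddE scalerDr.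
Qed.
Fact qscaleDl x : {morph qscale^~ x : a b / a + b}.
Proof.
move=> a b; rewrite -[RHS]/(qadd _ _) -(qpi_val x).
by rewrite !qscaleE qaddE scalerDl.
Qed.
HB.instance Definition _ := GRing.Zmodule_isLmodule.Build R quotm
  qscaleA qscale1 qscaleDr qscaleDl.

Lemma quotm_ex : exists p : {linear V -> quotm},
  surjective_map p /\ forall v, p v = 0 <-> S v.
Proof.
have pl : linear qpi.
  by move=> a u v; rewrite -[RHS]/(qadd (qscale _ _) _) qscaleE qaddE.
exists (mklin pl); split; first by move=> x; exists (val x); rewrite mklinE; apply: qpi_val.
move=> v; rewrite mklinE -[0]/(qpi 0); split=> [e|Sv]; last by apply: qpi_eq; rewrite subr0.
have := congr1 val e => /= {}e; rewrite -(subKr (rep v) v) {1}e.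
by apply: submodB (repP v) => //; have := repP 0; rewrite subr0.
Qed.

End Quotient.

Lemma quotient_exists (R : pzRingType) (V : lmodType R) (S : V -> Prop) :
  submod S -> exists (Q : lmodType R) (p : {linear V -> Q}),
  surjective_map p /\ forall v, p v = 0 <-> S v.
Proof. by move=> Ss; exists (quotm Ss); apply: quotm_ex. Qed.

(** * Zorn's lemma and Baer's criterion *)

Section Zorn.
Variables (R : pzRingType) (V : lmodType R).

Lemma zorn_submod (Phi : (V -> Prop) -> Prop) (S0 : V -> Prop) :
  submod S0 -> Phi S0 ->
  (forall F : (V -> Prop) -> Prop,
     (exists S, F S) -> (forall S, F S -> Phi S) ->
     (forall S T, F S -> F T -> (forall v, S v -> T v) \/ (forall v, T v -> S v)) ->
     Phi (fun v => exists S, F S /\ S v)) ->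
  exists S, [/\ submod S, Phi S, forall v, S0 v -> S v &
    forall T, submod T -> Phi T -> (forall v, S v -> T v) -> forall v, T v -> S v].
Proof.
move=> S0s PS0 Pch.
pose C := {S : V -> Prop | [/\ submod S, Phi S & forall v, S0 v -> S v]}.
pose le (X Y : C) := `[< forall v, sval X v -> sval Y v >].
have C0 : C by exists S0; split.
have [||F Ftot|[S [Ss PS S0S]] Smax] := @classical_sets.ZL_preorder C C0 le.
- by move=> X; apply/asboolP.
- by move=> X Y Z /asboolP XY /asboolP YZ; apply/asboolP => v /XY /YZ.
- have [[X0 FX0]|Fe] := pselect (exists X, F X); last first.
    by exists C0 => X FX; case: Fe; exists X.
  pose F' S := exists X, F X /\ sval X = S.
  have tot S T : F' S -> F' T -> (forall v, S v -> T v) \/ (forall v, T v -> S v).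
    move=> [X [FX <-]] [Y [FY <-]].
    by case: (Ftot X Y FX FY) => /asboolP; [left|right].
  pose U v := exists S, F' S /\ S v.
  have Us : submod U.
    split; first by exists (sval X0); split; [exists X0|case: (svalP X0) => /submod0].
    move=> a u v [S [FS Su]] [T [FT Tv]].
    have [S' [FS' S'u S'v]] : exists S', [/\ F' S', S' u & S' v].
      by case: (tot S T FS FT) => H; [exists T|exists S]; split=> //; apply: H.
    exists S'; split=> //; case: FS' => X [_ eX]; case: (svalP X); rewrite eX.
    by case=> _ H _ _; apply: H.
  have PU : Phi U.
    apply: Pch => //; first by exists (sval X0), X0.
    by move=> S [X [_ <-]]; case: (svalP X).
  have U0 v : S0 v -> U v.
    by move=> S0v; exists (sval X0); split; [exists X0|case: (svalP X0) => _ _; apply].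
  exists (exist _ U (And3 Us PU U0)) => X FX; apply/asboolP => v Xv /=.
  by exists (sval X); split=> //; exists X.
exists S; split=> // T Ts PT ST.
have S0T v : S0 v -> T v by move=> /S0S /ST.
by have /asboolP := Smax (exist _ T (And3 Ts PT S0T)) (asboolT ST).
Qed.

End Zorn.

Lemma graph_linear (R : pzRingType) (Y Z : lmodType R) (G : Y * Z -> Prop) :
  submod G -> (forall z, G (0, z) -> z = 0) -> (forall y, exists z, G (y, z)) ->
  exists h : {linear Y -> Z}, forall y, G (y, h y).
Proof.
move=> Gs G0 Gt; pose h y := sval (cid (Gt y)).
have hG y : G (y, h y) by apply: (svalP (cid (Gt y))).
have hl : linear h.
  move=> a u v; apply/subr0_eq/G0.
  have -> : (0, h (a *: u + v) - (a *: h u + h v)) =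
      (a *: u + v, h (a *: u + v)) - (a *: (u, h u) + (v, h v)) :> Y * Z.
    by rewrite -[RHS]/(_ - (_ + _), _ - (_ + _)) subrr.
  by apply: submodB => //; case: Gs => _; apply.
by exists (mklin hl) => y; rewrite mklinE.
Qed.

(** A maximal partial extension defined on a proper submodule [X] could be enlarged
    to an element [y] off [X], once maps from the ideal of all [a] with [a y] in [X]
    extend to [R].  So it is enough to test a class [KK] of ideals that always
    contains one of these.  The class of all ideals gives Baer's criterion. *)
Lemma baer (R : pzRingType) (Z : lmodType R) (KK : (R^o -> Prop) -> Prop) :
  (forall (K : R^o -> Prop) (Ks : submod K), KK K -> forall f : {linear subm Ks -> Z},
     exists z, forall x, f x = (subv x : R) *: z) ->
  (forall (V : lmodType R) (X : V -> Prop), submod X -> (exists y, ~ X y) ->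
     exists y, ~ X y /\ KK (fun a => X ((a : R) *: y))) ->
  injective_module Z.
Proof.
move=> KZ KV X Y g f ginj.
pose G0 (p : Y * Z) := exists x, p = (g x, f x).
have G0s : submod G0.
  split; first by exists 0; rewrite !linear0.
  by move=> a _ _ [x ->] [x' ->]; exists (a *: x + x'); rewrite !linP.
have [||G [Gs Gf GG0 Gmax]] :=
    @zorn_submod R (Y * Z)%type (fun G => forall z, G (0, z) -> z = 0) G0 G0s.
- by move=> z [x [gx ->]]; rewrite (ginj x 0) ?linear0.
- by move=> F _ FP _ z [S [FS Sz]]; apply: (FP S).
have Gt y : exists z, G (y, z).
  apply: contrapT => ny.
  pose D y := exists z, G (y, z).
  have Ds : submod D.
    split; first by exists 0; apply: (submod0 Gs).
    move=> a u v [z Gu] [w Gv]; exists (a *: z + w).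
    by case: Gs => _ H; apply: (H a (u, z) (v, w)).
  have [|{ny}y [nDy Ky]] := KV _ D Ds; first by exists y.
  have Ks : submod (fun a : R^o => D ((a : R) *: y)).
    split; first by rewrite scale0r; apply: submod0.
    by move=> a b c Db Dc; rewrite scalerDl -scalerA; apply Ds.
  pose GK (p : subm Ks * Z) := G ((subv p.1 : R) *: y, p.2).
  have GKs : submod GK.
    split; first by rewrite /GK linear0 scale0r; apply: (submod0 Gs).
    move=> a [b z] [c w]; rewrite /GK /= => Gb Gc; rewrite linP scalerDl -scalerA.
    by case: Gs => _ H; apply: (H a (_, z) (_, w)).
  have [||ff ffG] := graph_linear GKs.
  - by move=> z; rewrite /GK /= linear0 scale0r; apply: Gf.
  - by move=> a; have [z Gz] := subvP a; exists z.
  have [z0 z0P] := KZ _ Ks Ky ff.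
  pose G' (p : Y * Z) := exists q r, [/\ G q, exists a, r = a *: (y, z0) & p = q + r].
  have G's : submod G' by apply: submodDs => //; apply: submod_cyc.
  have G'f z : G' (0, z) -> z = 0.
    move=> [[u w] [_ [Guw [a ->]]]] [e ->].
    have Day : D (a *: y).
      exists (- w); move/eqP: e; rewrite eq_sym addrC addr_eq0 => /eqP ->.
      by rewrite -[(_, _)]/(- (u, w)); apply: submodN.
    have := ffG (msub Ks Day); rewrite z0P /GK /= msubK => Ga.
    apply: Gf; have := submodD Gs Guw Ga.
    by rewrite -[X in G X -> _]/(_, _) /= -e.
  apply: nDy; exists z0; apply: (Gmax G') => //.
    by move=> p Gp; exists p, 0; rewrite addr0; split=> //; exists 0; rewrite scale0r.
  by exists 0, (y, z0); rewrite add0r; split=> //; [apply: submod0|exists 1; rewrite scale1r].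
have [h hG] := graph_linear Gs Gf Gt.
exists h => x /=; apply/subr0_eq/Gf.
have -> : (0, h (g x) - f x) = (g x, h (g x)) - (g x, f x) :> Y * Z.
  by rewrite -[RHS]/(_ - _, _ - _) subrr.
by apply: submodB => //; apply: GG0; exists x.
Qed.

(** * Finite generation and chain conditions *)

Section Span.
Variable R : pzRingType.
Implicit Types V W : lmodType R.

(** Recursion on the generators: inductions on their number need no matrices. *)
Fixpoint span V (s : seq V) (v : V) : Prop :=
  if s is x :: s' then exists a, span s' (v - a *: x) else v = 0.

Lemma submod_span V (s : seq V) : submod (span s).
Proof.
elim: s => [|x s [s0 sl]]; first exact: submod00.
split; first by exists 0; rewrite scale0r subr0.
move=> a u v [b ub] [c vc]; exists (a * b + c).
by rewrite scalerDl -scalerA opprD addrACA -scalerBr; apply: sl.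
Qed.

Lemma span_min V (T : V -> Prop) (s : seq V) : submod T ->
  (forall x, x \in s -> T x) -> forall v, span s v -> T v.
Proof.
move=> Ts; elim: s => [_ v -> | x s IH xT v [a /IH sv]]; first exact: submod0.
rewrite -(subrK (a *: x) v); apply: submodD => //; last first.
  by apply: submodZ => //; apply: xT; rewrite mem_head.
by apply: sv => y ys; apply: xT; rewrite inE ys orbT.
Qed.

Lemma span_mem V (s : seq V) x : x \in s -> span s x.
Proof.
elim: s => // y s IH; rewrite inE => /orP[/eqP-> | /IH xs].
  by exists 1; rewrite scale1r subrr; apply: submod0 (submod_span s).
by exists 0; rewrite scale0r subr0.
Qed.

Lemma span_sub V (s t : seq V) v :
  (forall x, x \in s -> span t x) -> span s v -> span t v.
Proof. by move=> st; apply: span_min => //; apply: submod_span. Qed.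

Lemma span_subset V (s t : seq V) v : {subset s <= t} -> span s v -> span t v.
Proof. by move=> st; apply: span_sub => x /st; apply: span_mem. Qed.

Lemma span_map V W (f : {linear V -> W}) (s : seq V) v :
  span s v -> span [seq f x | x <- s] (f v).
Proof.
apply: (@span_min V (fun v => span [seq f x | x <- s] (f v))).
  exact: submod_preim (submod_span _).
by move=> x xs; apply: span_mem; apply: map_f.
Qed.

Definition fgm V : Prop := exists s : seq V, forall v, span s v.

Definition noeth V : Prop := forall S : V -> Prop, submod S ->
  exists s, forall v, S v <-> span s v.

Definition artin V : Prop := forall W : nat -> V -> Prop,
  (forall n, submod (W n)) -> (forall n v, W n.+1 v -> W n v) ->
  exists N, forall n v, (N <= n)%N -> W N v -> W n v.

Lemma fg_fgm V : finitely_generated V -> fgm V.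
Proof.
case=> m [b bP]; exists (codom b) => v; have [c ->] := bP v.
apply: submod_sum => [|i]; first exact: submod_span.
by apply: submodZ (submod_span _) _; apply: span_mem; apply: codom_f.
Qed.

Lemma fgm_surj V W (f : {linear V -> W}) : surjective_map f -> fgm V -> fgm W.
Proof.
move=> fs [s sV]; exists [seq f x | x <- s] => w.
by have [v <-] := fs w; apply: span_map.
Qed.

Lemma subm_fgm V (S : V -> Prop) (Ss : submod S) (s : seq V) :
  (forall v, S v <-> span s v) -> fgm (subm Ss).
Proof.
move=> sS; have sP x : x \in s -> S x by move=> xs; apply/sS/span_mem.
have [t ts] : exists t : seq (subm Ss), [seq subv x | x <- t] = s.
  elim: s {sS} sP => [_|x s IH sP]; first by exists [::].
  have [|t ts] := IH; first by move=> y ys; apply: sP; rewrite inE ys orbT.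
  by exists (msub Ss (sP x (mem_head x s)) :: t); rewrite /= ts msubK.
exists t => v; have /sS := subvP v; rewrite -ts.
move: v; elim: {s sS sP ts}t => [v /= v0|x t IH v [a vx]].
  by apply: subv_inj; rewrite v0 linear0.
by exists a; apply: IH; rewrite linearB linZ.
Qed.

(** Generators of the image, lifted, together with generators of the kernel. *)
Lemma span_ext V W (f : {linear V -> W}) (I : V -> Prop) (s : seq W) (t : seq V) :
  submod I ->
  (forall v, (exists u, I u /\ f u = v) <-> span s v) ->
  (forall v, I v /\ f v = 0 <-> span t v) ->
  exists r, forall v, I v <-> span r v.
Proof.
move=> Is sE tE.
have lift j : exists u, j \in s -> I u /\ f u = j.
  by have [/span_mem/sE[u Iu]|] := boolP (j \in s); [exists u|exists 0].
have [g gP] := choice lift.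
have tI v : span t v -> I v by move=> /tE[].
exists ([seq g j | j <- s] ++ t) => v; split=> [Iv|]; last first.
  apply: span_min => // x; rewrite mem_cat => /orP[/mapP[j js ->]|/span_mem/tI//].
  by case: (gP j js).
pose T w := exists u, [/\ I u, span [seq g j | j <- s] u & f u = w].
have [u [Iu gu fu]] : T (f v).
  have : span s (f v) by apply/sE; exists v.
  apply: (@span_min _ T) => [|j js]; last first.
    case: (gP j js) => Ij fj; exists (g j); split=> //.
    by apply/span_mem/map_f.
  split; first by exists 0; rewrite linear0; split=> //; apply: submod0 => //; apply: submod_span.
  move=> a _ _ [u [Iu gu <-]] [w [Iw gw <-]]; exists (a *: u + w); rewrite linP; split=> //.
    by case: Is => _; apply.
  by case: (submod_span [seq g j | j <- s]) => _; apply.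
rewrite -(subrK u v); apply: submodD (submod_span _) _ _; last first.
  by apply: span_subset gu => y; rewrite mem_cat => ->.
apply: (@span_subset _ t) => [y|]; first by rewrite mem_cat orbC => ->.
by apply/tE; split; [apply: submodB|rewrite linearB fu subrr].
Qed.

(** [S] embeds in the n-th power of the noetherian module [W]. *)
Lemma joint_kernel_fg V W n (l : nat -> {linear V -> W}) (S : V -> Prop) :
  noeth W -> submod S ->
  (forall v, S v -> (forall i, (i < n)%N -> l i v = 0) -> v = 0) ->
  exists s, forall v, S v <-> span s v.
Proof.
move=> noW; elim: n l S => [|n IH] l S Ss lS.
  by exists [::] => v; split=> [Sv|->]; [apply: lS|apply: submod0].
have [|s sE] := noW (fun w => exists v, S v /\ l 0%N v = w).
  split; first by exists 0; rewrite linear0; split=> //; apply: submod0.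
  move=> a _ _ [u [Su <-]] [w [Sw <-]]; exists (a *: u + w); rewrite linP; split=> //.
  by case: Ss => _; apply.
have [||t tE] := IH (fun i => l i.+1) (fun v => S v /\ l 0%N v = 0).
- by apply: submodI => //; apply: submod_ker.
- by move=> v [Sv lv] lsv; apply: lS => // -[|i] //; apply: lsv.
exact: span_ext sE tE.
Qed.

(** Chain conditions pass from [R] to finitely generated modules because a submodule
    [S] of the span of [x :: s] is known from its part in the span of [s] and from
    the ideal of the coefficients that [x] takes on [S]. *)
Definition coefs V (x : V) (s : seq V) (S : V -> Prop) (a : R^o) : Prop :=
  exists v, S v /\ span s (v - (a : R) *: x).

Lemma submod_coefs V (x : V) s (S : V -> Prop) : submod S -> submod (coefs x s S).
Proof.
move=> Ss; split.
  by exists 0; rewrite scale0r subr0; split; apply: submod0 => //; apply: submod_span.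
move=> a b c [u [Su sb]] [v [Sv sc]]; exists (a *: u + v); split; first by apply Ss.
rewrite scalerDl -scalerA opprD addrACA -scalerBr.
by case: (submod_span s) => _; apply.
Qed.

Lemma noeth_fgm V : noeth R^o -> fgm V -> noeth V.
Proof.
move=> noR [s sV] S Ss; have: forall v, S v -> span s v by [].
elim: s S Ss {sV} => [|x s IH] S Ss Ssp.
  by exists [::] => v; split=> [/Ssp|->] //; apply: submod0.
have [t' t'S] := IH _ (submodI Ss (submod_span s)) (fun v H => proj2 H).
have [js jsP] := noR _ (submod_coefs x s Ss).
have jS j : exists v, j \in js -> S v /\ span s (v - (j : R) *: x).
  have [js_j|] := boolP (j \in js); last by exists 0.
  by have /jsP [v Hv] := span_mem js_j; exists v.
have [g gP] := choice jS.
pose t := [seq g j | j <- js] ++ t'.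
exists t => v; split=> [Sv|]; last first.
  apply: span_min => // y; rewrite mem_cat => /orP[/mapP[j jj ->]|yt].
    by case: (gP j jj).
  by have /t'S[] := span_mem yt.
have [a va] := Ssp v Sv; have /jsP ja : coefs x s S a by exists v.
pose T (a : R^o) := exists u, span [seq g j | j <- js] u /\ span s (u - (a : R) *: x).
have [u [gu ua]] : T a.
  apply: (@span_min R^o T js) ja => [|j jj]; first exact: submod_coefs (submod_span _).
  by exists (g j); split; [apply/span_mem/map_f|case: (gP j jj)].
have Su : S u by apply: span_min gu => // _ /mapP[j jj ->]; case: (gP j jj).
rewrite -(subrK u v); apply: submodD (submod_span _) _ _; last first.
  by apply: span_subset gu => y; rewrite mem_cat => ->.
apply: (@span_subset V t') => [y|]; first by rewrite mem_cat orbC => ->.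
apply/t'S; split; first exact: submodB.
have -> : v - u = v - a *: x - (u - a *: x) by rewrite opprB addrA subrK.
exact: submodB (submod_span s) va ua.
Qed.

Lemma artin_fgm V : artin R^o -> fgm V -> artin V.
Proof.
move=> arR [s sV] W Ws Wd; have: forall n v, W n v -> span s v by [].
elim: s W Ws Wd {sV} => [|x s IH] W Ws Wd Wsp.
  by exists 0%N => n v _ /Wsp ->; apply: submod0.
have [|n v [Wv sv]||N1 N1P] := IH (fun n v => W n v /\ span s v).
- by move=> n; apply: submodI (submod_span s).
- by split=> //; apply: Wd.
- by move=> n v [].
have [||N2 N2P] := arR (fun n => coefs x s (W n)).
- by move=> n; apply: submod_coefs.
- by move=> n a [v [Wv sv]]; exists v; split=> //; apply: Wd.
have Wle n m v : (n <= m)%N -> W m v -> W n v.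
  elim: m => [|m IHm]; first by rewrite leqn0 => /eqP->.
  rewrite leq_eqVlt => /orP[/eqP->//|nm] /Wd; exact: IHm.
exists (maxn N1 N2) => n v nN Wv.
have [N1n N2n] : (N1 <= n)%N /\ (N2 <= n)%N by move: nN; rewrite geq_max => /andP.
have [a va] := Wsp _ _ Wv.
have [|w [Ww wa]] := N2P n a N2n.
  by exists v; split=> //; apply: Wle Wv; apply: leq_maxr.
rewrite -(subrK w v); apply: submodD => //.
have [] // := N1P n (v - w) N1n; split.
  apply: submodB => //; first by apply: Wle Wv; apply: leq_maxl.
  exact: Wle Ww.
have -> : v - w = v - a *: x - (w - a *: x) by rewrite opprB addrA subrK.
exact: submodB (submod_span s) va wa.
Qed.

(** Otherwise dependent choice gives a strictly decreasing sequence. *)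
Lemma artin_min V (Phi : (V -> Prop) -> Prop) : artin V ->
  (exists S, submod S /\ Phi S) ->
  exists S, [/\ submod S, Phi S &
    forall T, submod T -> Phi T -> (forall v, T v -> S v) -> forall v, S v -> T v].
Proof.
move=> arV [S0 [S0s PS0]]; apply: contrapT => nmin.
pose C := {S | submod S /\ Phi S}.
have step (X : C) : exists Y : C,
    (forall v, sval Y v -> sval X v) /\ ~ (forall v, sval X v -> sval Y v).
  apply: contrapT => nY; apply: nmin; exists (sval X).
  have [Xs PX] := svalP X; split=> // T Ts PT TX; apply: contrapT => XT.
  by apply: nY; exists (exist _ T (conj Ts PT)).
have [f fP] := choice step.
pose X n := iter n f (exist _ S0 (conj S0s PS0)).
have [n|n v|N NP] := arV (fun n => sval (X n)); first by case: (svalP (X n)).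
  by case: (fP (X n)) => H _ /H.
by case: (fP (X N)) => _; apply => v; apply: (NP N.+1 v (leqnSn N)).
Qed.

(** Maximal left ideals: modulo [K] every element off [K] has a left inverse. *)
Definition maxsub (K : R^o -> Prop) : Prop :=
  [/\ submod K, ~ K 1 & forall a, ~ K a -> exists c : R, K (1 - c *: a)].

Lemma submod_colon V (X : V -> Prop) y :
  submod X -> submod (fun a : R^o => X ((a : R) *: y)).
Proof.
move=> Xs; split; first by rewrite scale0r; apply: submod0.
by move=> a b c Xb Xc; rewrite scalerDl -scalerA; apply Xs.
Qed.

(** The cyclic submodule generated by [y0] in the quotient by [X] contains a simple
    module, coming from a minimal ideal above the annihilator of [y0]. *)
Lemma artin_simple V (X : V -> Prop) y0 : artin R^o -> submod X -> ~ X y0 ->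
  exists b : R, ~ X (b *: y0) /\ maxsub (fun a => X ((a : R) *: (b *: y0))).
Proof.
move=> arR Xs nX; pose J (a : R^o) := X ((a : R) *: y0).
have Js : submod J by apply: submod_colon.
have [|T [Ts [JT [b [Tb nJb]]] Tmin]] :=
  @artin_min R^o (fun T => (forall a, J a -> T a) /\ exists b, T b /\ ~ J b) arR.
  by exists (fun=> True); split=> //; split=> //; exists 1; rewrite /J scale1r.
exists b; split=> //; split; first exact: submod_colon.
  by rewrite scale1r.
move=> a; rewrite scalerA => nab.
pose T' (c : R^o) := exists u v, [/\ J u, exists d, v = d *: (a * b : R^o) & c = u + v].
have T's : submod T' by apply: submodDs => //; apply: submod_cyc.
have [|c|u [_ [Ju [d ->] bE]]] := Tmin T' T's _ _ b Tb.
- split=> [c Jc|]; first by exists c, 0; rewrite addr0; split=> //; exists 0; rewrite scale0r.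
  exists (a * b); split=> //; exists 0, (a * b); rewrite add0r; split=> //.
    exact: submod0.
  by exists 1; rewrite scale1r.
- move=> [u [_ [Ju [d ->] ->]]]; apply: submodD => //; first exact: JT.
  by do 2!apply: submodZ => //.
have e : ((1 : R) - d * a) *: ((b : R) *: y0) = (u : R) *: y0 :> V.
  by rewrite scalerA mulrBl mul1r -mulrA [X in X - _]bE addrK.
by exists d; rewrite -[X _]/(X (((1 : R) - d * a) *: ((b : R) *: y0))) e.
Qed.

End Span.

(** * Commutative artinian rings *)

Section Commutative.
Variable k : comPzRingType.
Implicit Types V N : lmodType k.

Lemma mulm_linear V (a : k) : linear (fun v : V => a *: v).
Proof. by move=> b u v; rewrite scalerDr !scalerA mulrC. Qed.
Definition mulm V (a : k) : {linear V -> V} := mklin (mulm_linear a).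
Lemma mulmE V a (v : V) : mulm V a v = a *: v. Proof. exact: mklinE. Qed.

Lemma artinianP : artinian k -> artin k^o.
Proof.
move=> ark W Ws Wd; pose J n : {pred k^o} := fun v => `[< W n v >].
have [n|n v|N NP] := ark J.
- split=> [|a u v]; rewrite !unfold_in; first by apply/asboolP; apply: submod0.
  by move=> /asboolP Wu /asboolP Wv; apply/asboolP; case: (Ws n) => _; apply.
- by rewrite !unfold_in => /asboolP Wv; apply/asboolP/Wd.
exists N => n v Nn Wv; have := NP n Nn v; rewrite !unfold_in => e.
by apply/asboolP; rewrite e; apply/asboolP.
Qed.

(** A minimal ideal [I] that is not finitely generated would be killed or mapped
    onto itself by every scalar, for otherwise image and kernel of the scalar on [I]
    would be smaller, hence finitely generated.  A scalar of the second kind is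
    invertible on [I], so that [I] is a vector space all of whose proper subspaces
    are finitely generated; adding one vector to a hyperplane shows that [I] is
    finitely generated too. *)
Lemma artin_noeth : artin k^o -> noeth k^o.
Proof.
move=> ark; apply: contrapT => /existsNP[I0 /not_implyP[I0s nI0]].
have [|I [Is nI Imin]] := @artin_min _ k^o
  (fun I => ~ exists s, forall v, I v <-> span s v) ark.
  by exists I0.
have fg T : submod T -> (forall v, T v -> I v) -> (exists v, I v /\ ~ T v) ->
    exists s, forall v, T v <-> span s v.
  move=> Ts TI [v [Iv nTv]]; apply: contrapT => nT; apply: nTv.
  exact: (Imin T).
(* Otherwise both the image and the kernel of a on I are proper in I. *)
have act (a : k) : (forall x, I x -> a *: x = 0) \/
    (forall x, I x -> exists y, I y /\ a *: y = x).
  apply: contrapT => /not_orP[/existsNP[x0 /not_implyP[Ix0 ax0]] /existsNP[x1 /not_implyP[Ix1 ax1]]].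
  have [|||s sE] := fg (fun v => exists u, I u /\ mulm k^o a u = v).
  - split; first by exists 0; rewrite linear0; split=> //; apply: submod0.
    move=> b _ _ [u [Iu <-]] [w [Iw <-]]; exists (b *: u + w); rewrite linP; split=> //.
    by case: Is => _; apply.
  - by move=> _ [u [Iu <-]]; rewrite mulmE; apply: submodZ.
  - by exists x1; split=> // -[y [Iy]]; rewrite mulmE => yx; apply: ax1; exists y.
  have [|||t tE] := fg (fun v => I v /\ mulm k^o a v = 0).
  - by apply: submodI => //; apply: submod_ker.
  - by move=> v [].
  - by exists x0; split=> // -[_]; rewrite mulmE; apply: ax0.
  by apply: nI; apply: span_ext sE tE.
have inv a : ~ (forall x, I x -> a *: x = 0) -> exists c : k, forall x, I x -> (c * a) *: x = x.
  case: (act a) => // aI _.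
  (* The powers of a generate a decreasing sequence of ideals. *)
  have [||N NP] := ark (fun n (x : k^o) => exists b : k, x = b *: (a ^+ n : k^o)).
  - by move=> n; apply: submod_cyc.
  - by move=> n _ [b ->]; exists (b * a); rewrite -scalerA exprS.
  have [|c ec] := NP N.+1 (a ^+ N) (leqnSn N); first by exists 1; rewrite scale1r.
  have aNI x : I x -> exists y, I y /\ (a ^+ N : k) *: y = x.
    elim: (N) x => [|n IHn] x Ix; first by exists x; rewrite scale1r.
    have [y [Iy <-]] := aI x Ix; have [z [Iz <-]] := IHn y Iy.
    by exists z; rewrite scalerA exprS.
  exists c => x /aNI[y [_ <-]]; rewrite scalerA; congr (_ *: _).
  by rewrite {2}ec -mulrA -exprS.
have [x0 [Ix0 x0n]] : exists x, I x /\ x <> 0.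
  apply: contrapT => nx; apply: nI; exists [::] => v; split=> [Iv|->]; last exact: submod0.
  by apply: contrapT => v0; apply: nx; exists v.
(* A hyperplane H of I avoiding x0. *)
have [||H [Hs [HI nHx] _ Hmax]] := @zorn_submod _ k^o
    (fun H => (forall v, H v -> I v) /\ ~ H x0) _ (submod00 _).
- by split=> // v ->; apply: submod0.
- move=> F _ FP _; split=> [v [S [FS Sv]]|[S [FS]]]; last by case: (FP S FS).
  by case: (FP S FS) => SI _; apply: SI.
have [|||s sH] := fg H => //; first by exists x0.
apply: nI; exists (x0 :: s) => v; split; last first.
  apply: span_min => // y; rewrite inE => /orP[/eqP->//|/span_mem/sH]; exact: HI.
move=> Iv; have [/sH Hv|nHv] := pselect (H v).
  by apply: span_subset Hv => y ys; rewrite inE ys orbT.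
pose T x := exists h z, [/\ H h, exists a, z = a *: v & x = h + z].
have Ts : submod T by apply: submodDs => //; apply: submod_cyc.
have : T x0.
  apply: contrapT => nT; apply: nHv; apply: (Hmax T) => //.
  - split=> // x [h [_ [Hh [a ->] ->]]]; apply: submodD => //; first exact: HI.
    exact: submodZ.
  - by move=> x Hx; exists x, 0; rewrite addr0; split=> //; exists 0; rewrite scale0r.
  - by exists 0, v; rewrite add0r; split=> //; [apply: submod0|exists 1; rewrite scale1r].
move=> [h [_ [Hh [a ->] x0E]]].
have [|c cP] := inv a.
  by move=> aI; apply: nHx; rewrite x0E aI // addr0.
exists c; apply/sH; have -> : v - c *: x0 = - (c *: h).
  by rewrite x0E scalerDr scalerA cP // opprD addrCA subrr addr0.
by apply: submodN => //; apply: submodZ.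
Qed.

End Commutative.

(** * Finitely generated injectives over a commutative artinian ring *)

Section Hull.
Variable k : comPzRingType.
Implicit Types V N : lmodType k.
Hypothesis ark : artin k^o.
Let nok : noeth k^o := artin_noeth ark.

(** From the head down: each entry spans a simple module modulo the span of the
    entries after it. *)
Fixpoint comp_series (rs : seq k^o) : Prop :=
  if rs is r :: rs' then maxsub (fun a : k^o => span rs' ((a : k) *: r)) /\ comp_series rs'
  else True.

(** An ideal that is maximal among those spanned by such a series is the unit ideal,
    because the quotient by a proper ideal contains a simple module. *)
Lemma comp_series_exists : exists rs, comp_series rs /\ span rs (1 : k^o).
Proof.
pose Phi (I : k^o -> Prop) := exists rs, comp_series rs /\ forall a, I a <-> span rs a.
have [||I [Is [rs [crs rsI]] _ Imax]] := @zorn_submod _ k^o Phi _ (submod00 _).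
- by exists [::].
- move=> F [S0 FS0] FP Ftot; pose U v := exists S, F S /\ S v.
  have Fs S : F S -> submod S.
    move=> /FP[rs [_ rsS]]; split; first by apply/rsS; apply: submod0 (submod_span _).
    move=> a u v /rsS Su /rsS Sv; apply/rsS.
    by case: (submod_span rs) => _; apply.
  have Us : submod U.
    split; first by exists S0; split=> //; apply: submod0 (Fs _ FS0).
    move=> a u v [S [FS Su]] [T [FT Tv]].
    have [ST|TS] := Ftot S T FS FT; [exists T|exists S]; split=> //.
      by case: (Fs T FT) => _; apply=> //; apply: ST.
    by case: (Fs S FS) => _; apply=> //; apply: TS.
  have [s sU] := nok Us.
  have [S [FS sS]] : exists S, F S /\ forall x, x \in s -> S x.
    have: forall x, x \in s -> U x by move=> x xs; apply/sU/span_mem.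
    elim: (s) => [|x t IH] tU; first by exists S0.
    have [|T [FT tT]] := IH; first by move=> y yt; apply: tU; rewrite inE yt orbT.
    have [S [FS Sx]] := tU x (mem_head x t).
    have [ST|TS] := Ftot S T FS FT; [exists T|exists S]; split=> // y;
      rewrite inE => /orP[/eqP->|/tT] //; [exact: ST|exact: TS].
  have [rs [crs rsS]] := FP S FS; exists rs; split=> // a; split=> [/sU sa|/rsS Sa].
    by apply/rsS; apply: span_min sa => //; apply: Fs.
  by exists S.
exists rs; split=> //; apply: contrapT => n1.
have [b [nb mb]] := artin_simple ark (submod_span rs) n1.
pose r : k^o := b *: (1 : k^o); have rrs : span (r :: rs) r by apply: span_mem; rewrite inE eqxx.
apply: nb; apply/rsI; apply: (Imax _ (submod_span (r :: rs)) _ _ r rrs).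
  by exists (r :: rs); split.
by move=> v /rsI; apply: span_subset => y ys; rewrite inE ys orbT.
Qed.

(** [N] is an essential extension of the simple module generated by [e]; [m] is the
    annihilator of [e] when it is a maximal ideal. *)
Definition ess_ext (m : k^o -> Prop) N (e : N) : Prop :=
  [/\ e <> 0, forall a : k, m a -> a *: e = 0 &
      forall x : N, x <> 0 -> exists c : k, c *: x = e].

Definition killed N (rs : seq k^o) (x : N) : Prop :=
  forall r : k, r \in rs -> r *: x = 0.

(** The number of strict steps in the filtration of [N] by the annihilators of the
    ideals of the series.  By [ess_coset] the steps are at most simple, so this is
    the length of [N] when [N] is essential over a simple module. *)
Fixpoint ann_len N (rs : seq k^o) : nat :=
  if rs is r :: rs' then
    (`[< exists x : N, killed rs' x /\ (r : k) *: x <> 0%R >] + ann_len N rs')%N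
  else 0%N.

Lemma ann_len_size N rs : (ann_len N rs <= size rs)%N.
Proof. by elim: rs => //= r rs IH; case: asbool => //=; apply: leqW. Qed.

Lemma killed_span N rs (x : N) : killed rs x ->
  forall a : k^o, span rs a -> (a : k) *: x = 0.
Proof.
move=> kx; apply: span_min => //; split; first exact: scale0r.
by move=> a b c bx cx; rewrite scalerDl -scalerA bx cx scaler0 addr0.
Qed.

(** Both [r x] and [r z] are killed by a maximal ideal, and some multiples of them
    equal [e]; so [r x] is a multiple of [r z]. *)
Lemma ess_coset m N (e : N) r rs (x z : N) : ess_ext m e ->
  maxsub (fun a : k^o => span rs ((a : k) *: r)) ->
  killed rs x -> killed rs z -> (r : k) *: z <> 0 ->
  exists b : k, killed (r :: rs) (x - b *: z).
Proof.
move=> [ne _ eN] [_ _ mr] kx kz rz.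
have kb b : (r : k) *: (x - b *: z) = 0 -> killed (r :: rs) (x - b *: z).
  move=> rb a; rewrite inE => /orP[/eqP->//|ars].
  by rewrite scalerBr kx // scalerA mulrC -scalerA kz // scaler0 subr0.
have [rx|rx] := pselect ((r : k) *: x = 0).
  by exists 0; apply: kb; rewrite scale0r subr0.
have [c' c'E] := eN _ rz; have [c cE] := eN _ rx.
have [|d dE] := mr c.
  by move=> mc; apply: ne; rewrite -cE scalerA; apply: (killed_span kx mc).
have rxE : (r : k) *: x = d *: e.
  apply/eqP; rewrite -subr_eq0 -cE [d *: _]scalerA -{1}[(r : k) *: x]scale1r -scalerBl scalerA.
  exact/eqP/(killed_span kx dE).
exists (d * c'); apply: kb; rewrite scalerBr rxE -c'E !scalerA.
by rewrite [(r : k) * _]mulrC ?mulrA subrr.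
Qed.

Section Ext.
Variables (m : k^o -> Prop) (N N' : lmodType k) (j : {linear N -> N'}) (e : N).
Hypotheses (j_inj : injective j) (essN' : ess_ext m (j e)).

Let j0 x : j x = 0 -> x = 0.
Proof. by move=> jx; apply: j_inj; rewrite jx linear0. Qed.

Let killed_j rs x : killed rs x -> killed rs (j x).
Proof. by move=> kx r rs_r; rewrite -linZ kx // linear0. Qed.

Lemma ann_len_le rs : (ann_len N rs <= ann_len N' rs)%N.
Proof.
elim: rs => //= r rs IH; apply: leq_add => //.
case: asboolP => // -[x [kx rx]]; case: asboolP => // -[]; exists (j x).
by split; [apply: killed_j|rewrite -linZ => /j0].
Qed.

(** When [N'] is not longer than [N], each step of its filtration is already reached
    by an element of [N]. *)
Lemma ess_surj rs : comp_series rs -> span rs (1 : k^o) ->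
  (ann_len N' rs <= ann_len N rs)%N -> surjective_map j.
Proof.
move=> crs rs1 len.
have im0 x' : killed rs x' -> exists x, j x = x'.
  by move=> kx'; exists 0; rewrite linear0 -(killed_span kx' rs1) scale1r.
have H : forall x', killed [::] x' -> exists x, j x = x'.
  elim: rs {rs1} crs len im0 => // r rs IH [mr crs] /= len im.
  have len' := ann_len_le rs; apply: IH => //.
    move: len; case: asboolP => [_|nx']; case: asboolP => [[x [kx rx]]|_] //.
      by rewrite add1n; apply: ltnW.
    by case: nx'; exists (j x); split; [apply: killed_j|rewrite -linZ => /j0].
  move=> x' kx'; have [rx'|rx'] := pselect ((r : k) *: x' = 0).
    by apply: im => a; rewrite inE => /orP[/eqP->//|/kx'].
  have [y [ky ry]] : exists x : N, killed rs x /\ (r : k) *: x <> 0.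
    apply: contrapT => nx; move: len; case: asboolP => // -[]; last by exists x'.
    by case: asboolP => // _; rewrite add0n add1n ltnNge len'.
  have [|b kb] := ess_coset essN' mr kx' (killed_j ky); first by rewrite -linZ => /j0.
  have [x jx] := im _ kb.
  by exists (x + b *: y); rewrite linearD linZ jx subrK.
by move=> x'; apply: H.
Qed.

End Ext.

(** One generator for each strict step of the filtration. *)
Lemma ess_fgm m N (e : N) : ess_ext m e -> fgm N.
Proof.
move=> eN; have [rs [crs rs1]] := comp_series_exists.
have im0 : exists s : seq N, forall x, killed rs x -> span s x.
  by exists [::] => x kx; rewrite /= -(killed_span kx rs1) scale1r.
suff [s sP] : exists s : seq N, forall x, killed [::] x -> span s x.
  by exists s => x; apply: sP.
elim: rs crs {rs1} im0 => // r rs IH [mr crs] [s sP]; apply: IH => //.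
have [ex|nex] := pselect (exists x : N, killed rs x /\ (r : k) *: x <> 0); last first.
  exists s => x kx; apply: sP => a; rewrite inE => /orP[/eqP->|/kx//].
  by apply: contrapT => rx; apply: nex; exists x.
have [y0 [ky0 ry0]] := ex.
exists (y0 :: s) => x kx; have [b kb] := ess_coset eN mr kx ky0 ry0.
by exists b; apply: sP.
Qed.

End Hull.

Section Cogenerator.
Variable k : comPzRingType.
Hypothesis ark : artin k^o.
Implicit Types V N : lmodType k.

Lemma ess_quot m : maxsub m -> exists (N : lmodType k) (e : N), ess_ext m e.
Proof.
move=> [ms m1 mm]; have [N [p [ps pK]]] := quotient_exists ms.
exists N, (p (1 : k^o)); split=> [/pK//|a ma|x x0].
  by rewrite -linZ; apply/pK; rewrite -[_ *: _]/(a * 1) mulr1.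
have [a ax] := ps x; have [|c mc] := mm a; first by move/pK; rewrite ax.
exists c; rewrite -ax -linZ; apply/esym/subr0_eq; rewrite -linearB.
exact/pK.
Qed.

(** Baer's criterion: the pushout of [N] along an ideal [K], divided by a maximal
    submodule that meets [N] in 0, is again an essential extension.  It cannot be
    longer than [N], hence it equals [N], which gives the extension of the map. *)
Lemma ess_max_injective m N (e : N) (rs : seq k^o) : ess_ext m e ->
  comp_series rs -> span rs (1 : k^o) ->
  (forall N' (e' : N'), ess_ext m e' -> (ann_len N' rs <= ann_len N rs)%N) ->
  injective_module N.
Proof.
move=> eN crs rs1 Nmax; apply: (@baer _ _ (fun=> True)) => [K Ks _ f|]; last first.
  by move=> V X _ [y ny]; exists y.
(* The pushout is the quotient of N * k by L; C is L with the complement added. *)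
pose L (p : N * k^o) := exists x : subm Ks, p = (f x, - subv x).
have Ls : submod L.
  split; first by exists 0; rewrite !linear0.
  move=> a _ _ [x ->] [y ->]; by exists (a *: x + y); rewrite !linP.
have [||C [Cs C0 LC Cmax]] := @zorn_submod _ (N * k^o)%type
    (fun C => forall x, C (x, 0) -> x = 0) L Ls.
- move=> x [y [-> /eqP]]; rewrite eq_sym oppr_eq0 => /eqP y0.
  by rewrite (_ : y = 0) ?linear0 //; apply: subv_inj; rewrite y0 linear0.
- by move=> F _ FP _ x [S [FS Sx]]; apply: (FP S).
have [Q [p [ps pK]]] := quotient_exists Cs.
have il : linear (fun x : N => (x, 0) : N * k^o).
  by move=> a x y; rewrite -[RHS]/(a *: x + y, a *: 0 + 0) scaler0 addr0.
pose j : {linear N -> Q} := p \o mklin il.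
have jE x : j x = p (x, 0) by rewrite /j /= mklinE.
have j_inj : injective j by apply: linear_inj0 => x; rewrite jE => /pK/C0.
have eQ : ess_ext m (j e).
  have [ne me ee] := eN; split=> [je|a ma|q nq].
  - by apply: ne; apply: j_inj; rewrite je linear0.
  - by rewrite -linZ me // linear0.
  have [v pv] := ps q.
  have [x [x0 [c Cx]]] : exists x, x <> 0 /\ exists c : k, C ((x, 0) - c *: v).
    apply: contrapT => nx; apply: nq; rewrite -pv; apply/pK.
    pose T w := exists u z, [/\ C u, exists a, z = a *: v & w = u + z].
    apply: (Cmax T); first by apply: submodDs => //; apply: submod_cyc.
    - move=> x [u [_ [Cu [a ->] xE]]]; apply: contrapT => x0; apply: nx.
      by exists x; split=> //; exists a; rewrite xE addrK.
    - by move=> w Cw; exists w, 0; rewrite addr0; split=> //; exists 0; rewrite scale0r.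
    by exists 0, v; rewrite add0r; split=> //; [apply: submod0|exists 1; rewrite scale1r].
  have [b bx] := ee x x0; exists (b * c).
  have -> : j e = b *: j x by rewrite -bx linZ.
  rewrite -scalerA; congr (_ *: _); apply/esym/subr0_eq.
  by rewrite jE -pv -linZ -linearB; apply/pK.
have [z jz] := ess_surj j_inj eQ crs rs1 (Nmax _ _ eQ) (p (0, 1)).
exists z => x; apply/subr0_eq/C0.
pose c : k := subv x; pose w : N * k^o := (z, 0) - (0, 1).
have Cw : C w by apply/pK; rewrite linearB -jz jE subrr.
have -> : (f x - c *: z, 0) = (f x, - subv x) - c *: w :> N * k^o.
  rewrite -[RHS]/(f x - c *: (z - 0), - c - c * (0 - 1)).
  by rewrite subr0 sub0r mulrN1 subrr.
apply: submodB => //; last exact: submodZ.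
by apply: LC; exists x.
Qed.

(** The injective hulls of the simple modules are finitely generated, because the
    length of a composition series of [k] bounds the length of all essential
    extensions. *)
Lemma fg_injective_cogenerator V (t : V) : t <> 0 ->
  exists (E : lmodType k) (h : {linear V -> E}),
    [/\ injective_module E, fgm E & h t <> 0].
Proof.
move=> t0; have [b [bt mm]] := artin_simple ark (submod00 V) t0.
set m := fun _ => _ in mm; have [N0 [e0 eN0]] := ess_quot mm.
have [rs [crs rs1]] := comp_series_exists ark.
pose P n := `[< exists (N : lmodType k) (e : N), ess_ext m e /\ ann_len N rs = n >].
have exP : exists n, P n.
  by exists (ann_len N0 rs); apply/asboolP; exists N0, e0.
have [|n /asboolP[N [e [eN <-]]] Nmax] := @ex_maxnP P (size rs) exP.
  by move=> n /asboolP[N [e [_ <-]]]; apply: ann_len_size.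
have injN : injective_module N.
  apply: (ess_max_injective eN crs rs1) => N' e' eN'; apply: Nmax.
  by apply/asboolP; exists N', e'.
have cl V' (x : V') : linear (fun a : k^o => (a : k) *: x).
  by move=> a u v; rewrite scalerDl -scalerA.
have [|h hP] := @inj_factor _ _ _ N (mklin (cl _ (b *: t))) (mklin (cl _ e)) injN.
  by move=> a; rewrite !mklinE => ma; have [_ H _] := eN; apply: H.
exists N, h; split=> //; first exact: ess_fgm ark _ _ _ eN.
move=> ht; have [ne _ _] := eN; apply: ne.
by have := hP (1 : k); rewrite !mklinE !scale1r linZ ht scaler0.
Qed.

End Cogenerator.

(** * Duality for modules over an Artin algebra *)

Section Algebra.
Variables (k : comPzRingType) (A : algType k).
Local Notation Lam := (A^c^o : lmodType A^c).
Implicit Types V W F P : lmodType A^c.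

Definition scl (c : k) : A^c := c%:A.

Lemma scl_mulr c (a : A^c) : a * scl c = scl c * a.
Proof. by rewrite -[LHS]/(c%:A * (a : A)) -[RHS]/((a : A) * c%:A) mulr_algl mulr_algr. Qed.
Lemma scl1 : scl 1 = 1. Proof. exact: scale1r. Qed.
Lemma sclD c d : scl (c + d) = scl c + scl d. Proof. exact: scalerDl. Qed.
Lemma sclM c d : scl (c * d) = scl c * scl d.
Proof. by rewrite -[RHS]/((d%:A : A) * c%:A) mulr_algl scalerA mulrC. Qed.

Section Restriction.
Variable V : lmodType A^c.
Definition rst : Type := V.
HB.instance Definition _ := GRing.Zmodule.on rst.
Definition rst_scale (c : k) (v : rst) : rst := scl c *: (v : V).
Fact rst_scaleA a b v : rst_scale a (rst_scale b v) = rst_scale (a * b) v.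
Proof. by rewrite /rst_scale scalerA sclM. Qed.
Fact rst_scale1 : left_id 1 rst_scale.
Proof. by move=> v; rewrite /rst_scale scl1 scale1r. Qed.
Fact rst_scaleDr : right_distributive rst_scale +%R.
Proof. by move=> a u v; apply: scalerDr. Qed.
Fact rst_scaleDl v : {morph rst_scale^~ v : a b / a + b}.
Proof. by move=> a b; rewrite /rst_scale sclD scalerDl. Qed.
HB.instance Definition _ := GRing.Zmodule_isLmodule.Build k rst
  rst_scaleA rst_scale1 rst_scaleDr rst_scaleDl.
End Restriction.

Lemma rstZ V (c : k) (v : rst V) : c *: v = scl c *: (v : V). Proof. by []. Qed.

Lemma submod_rst V (S : V -> Prop) : submod S -> submod (S : rst V -> Prop).
Proof. by case=> S0 Sl; split=> // a u v Su Sv; rewrite rstZ; apply: Sl. Qed.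

Lemma span_rst V (s : seq (rst V)) v : span s v -> span (s : seq V) v.
Proof. by elim: s v => //= x s IH v [a /IH sv]; exists (scl a). Qed.

Lemma fgm_rst V : fgm (rst V) -> fgm V.
Proof. by case=> s sV; exists s => v; apply: span_rst. Qed.

Lemma noeth_rst V : noeth (rst V) -> noeth V.
Proof.
move=> noV S Ss; have [s sS] := noV _ (submod_rst Ss).
exists s => v; split=> [/sS/span_rst//|].
by apply: span_min => // x xs; apply/sS/span_mem.
Qed.

Lemma artin_rst V : artin (rst V) -> artin V.
Proof. by move=> arV W Ws Wd; apply: arV => // n; apply: submod_rst. Qed.

Lemma fgm_rst_Lam : finitely_generated A -> fgm (rst Lam).
Proof.
move/fg_fgm; have il : linear (id : A -> rst Lam).
  by move=> c u v; rewrite rstZ -[scl c *: _]/((u : A) * c%:A) mulr_algr.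
by apply: (@fgm_surj _ _ _ (mklin il)) => a; exists a; rewrite mklinE.
Qed.

Section Hom.
Variables P F : lmodType A^c.

Definition is_linear (u : prodm (fun _ : P => (rst F : lmodType k))) : Prop :=
  forall a (p q : P), u (a *: p + q) = (a *: (u p : F) + u q : F).

Lemma submod_is_linear : submod is_linear.
Proof.
split=> [a p q|c u v ul vl a p q]; first by rewrite !prodm0 -[RHS]/(a *: 0 + 0 : F) scaler0 addr0.
rewrite !prodmD !prodmZ ul vl -[RHS]/(a *: (scl c *: (u p : F) + v p) + (scl c *: (u q : F) + v q) : F).
rewrite -[LHS]/(scl c *: (a *: (u p : F) + u q) + (a *: (v p : F) + v q) : F).
by rewrite !scalerDr !scalerA scl_mulr addrACA.
Qed.

Definition homm : lmodType k := subm submod_is_linear.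

Lemma hval_exists (u : homm) : {f : {linear P -> F} | forall p, f p = subv u p}.
Proof. by exists (mklin (subvP u : linear (subv u : P -> F))) => p; rewrite mklinE. Qed.
Definition hval (u : homm) : {linear P -> F} := sval (hval_exists u).
Lemma hvalE u p : hval u p = subv u p. Proof. exact: (svalP (hval_exists u)). Qed.

Definition hmk (f : {linear P -> F}) : homm :=
  msub submod_is_linear (linP f : is_linear (fun p => f p)).

Lemma hmkK f : hval (hmk f) =1 f.
Proof. by move=> p; rewrite hvalE /hmk msubK. Qed.

Lemma hval_inj u v : hval u =1 hval v -> u = v.
Proof.
by move=> uv; apply: subv_inj; apply: prodm_ext => p; rewrite -!hvalE; apply: uv.
Qed.

Lemma hvalP c u v p : hval (c *: u + v) p = scl c *: hval u p + hval v p.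
Proof. by rewrite !hvalE linP. Qed.

Lemma hval0 p : hval 0 p = 0.
Proof. by rewrite !hvalE linear0. Qed.

End Hom.
End Algebra.

Section HomFunctors.
Variables (k : comPzRingType) (A : algType k).
Local Notation Lam := (A^c^o : lmodType A^c).
Implicit Types V W F G P Q : lmodType A^c.

Section Functors.
Variables P Q F G : lmodType A^c.

Lemma precomp_linear (d : {linear Q -> P}) :
  linear (fun u : homm P F => hmk (hval u \o d : {linear Q -> F})).
Proof.
by move=> c u v; apply: hval_inj => q; rewrite hvalP !hmkK /= hvalP.
Qed.
Definition precomp (d : {linear Q -> P}) : {linear homm P F -> homm Q F} :=
  mklin (precomp_linear d).
Lemma precompE d u q : hval (precomp d u) q = hval u (d q).
Proof. by rewrite /precomp mklinE hmkK. Qed.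

Lemma postcomp_linear (f : {linear F -> G}) :
  linear (fun u : homm P F => hmk (f \o hval u : {linear P -> G})).
Proof.
by move=> c u v; apply: hval_inj => q; rewrite hvalP !hmkK /= hvalP linP.
Qed.
Definition postcomp (f : {linear F -> G}) : {linear homm P F -> homm P G} :=
  mklin (postcomp_linear f).
Lemma postcompE f u q : hval (postcomp f u) q = f (hval u q).
Proof. by rewrite /postcomp mklinE hmkK. Qed.

(** In the notation of right modules, the rank one map p |-> x u(p). *)
Lemma rk1_linear_l x (u : homm P Lam) : linear (fun p => (hval u p : A^c) *: (x : F)).
Proof. by move=> a p q; rewrite linP scalerDl -scalerA. Qed.
Lemma rk1_linear (x : F) : linear (fun u : homm P Lam => hmk (mklin (rk1_linear_l x u))).
Proof.
move=> c u v; apply: hval_inj => p.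
by rewrite hvalP !hmkK !mklinE hvalP scalerDl -scalerA.
Qed.
Definition rk1 (x : F) : {linear homm P Lam -> homm P F} := mklin (rk1_linear x).
Lemma rk1E x u p : hval (rk1 x u) p = (hval u p : A^c) *: x.
Proof. by rewrite /rk1 mklinE hmkK mklinE. Qed.

End Functors.

Lemma lact_exists P (a : A^c) : {f : {linear homm P Lam -> homm P Lam} |
  forall u p, hval (f u) p = (hval u p : A^c) * a}.
Proof. by exists (rk1 P (a : Lam)) => u p; rewrite rk1E. Qed.
Definition lact P a := sval (lact_exists P a).
Lemma lactE P a (u : homm P Lam) p : hval (lact P a u) p = (hval u p : A^c) * a.
Proof. exact: (svalP (lact_exists P a)). Qed.

Section Dual.
Variables (P : lmodType A^c) (E : lmodType k).

Definition is_klinear (y : prodm (fun _ : homm P Lam => E)) : Prop := linear y.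

Lemma submod_is_klinear : submod is_klinear.
Proof.
split=> [c u v|c y z yl zl b u v]; first by rewrite !prodm0 scaler0 addr0.
by rewrite !prodmD !prodmZ yl zl !scalerDr !scalerA mulrC addrACA.
Qed.

(** The Nakayama functor Hom_k (Hom_R (P, R), E), on projectives that need not be
    finitely generated. *)
Definition dualm : Type := subm submod_is_klinear.
HB.instance Definition _ := GRing.Zmodule.on dualm.

Lemma dval_exists (y : dualm) : {f : {linear homm P Lam -> E} |
  forall u, f u = subv (y : subm submod_is_klinear) u}.
Proof.
exists (mklin (subvP (y : subm submod_is_klinear) : linear (subv (y : subm _)))) => u.
by rewrite mklinE.
Qed.
Definition dval (y : dualm) : {linear homm P Lam -> E} := sval (dval_exists y).
Lemma dvalE y u : dval y u = subv (y : subm submod_is_klinear) u.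
Proof. exact: (svalP (dval_exists y)). Qed.

Definition dmk (f : {linear homm P Lam -> E}) : dualm :=
  msub submod_is_klinear (linP f : is_klinear (fun u => f u)).

Lemma dmkK f : dval (dmk f) =1 f.
Proof. by move=> u; rewrite dvalE msubK. Qed.
Lemma dval_inj y z : dval y =1 dval z -> y = z.
Proof. by move=> yz; apply: (@subv_inj _ _ _ submod_is_klinear); apply: prodm_ext => u; rewrite -!dvalE. Qed.
Lemma dvalD y z u : dval (y + z) u = dval y u + dval z u.
Proof. by rewrite !dvalE linearD. Qed.
Lemma dval0 u : dval 0 u = 0.
Proof. by rewrite !dvalE linear0. Qed.

Definition dscale (a : A^c) (y : dualm) : dualm := dmk (dval y \o lact P a).
Lemma dscaleE a y u : dval (dscale a y) u = dval y (lact P a u).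
Proof. by rewrite /dscale dmkK. Qed.

Fact dscaleA a b y : dscale a (dscale b y) = dscale (a * b) y.
Proof.
apply: dval_inj => u; rewrite !dscaleE; congr (dval y _).
by apply: hval_inj => p; rewrite !lactE mulrA.
Qed.
Fact dscale1 : left_id 1 dscale.
Proof.
move=> y; apply: dval_inj => u; rewrite !dscaleE; congr (dval y _).
by apply: hval_inj => p; rewrite lactE mulr1.
Qed.
Fact dscaleDr : right_distributive dscale +%R.
Proof. by move=> a y z; apply: dval_inj => u; rewrite dvalD !dscaleE dvalD. Qed.
Fact dscaleDl y : {morph dscale^~ y : a b / a + b}.
Proof.
move=> a b; apply: dval_inj => u; rewrite dvalD !dscaleE -linearD; congr (dval y _).
apply: hval_inj => p; rewrite -[lact P a u]scale1r hvalP !lactE scl1 scale1r.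
exact: mulrDr.
Qed.
HB.instance Definition _ := GRing.Zmodule_isLmodule.Build A^c dualm
  dscaleA dscale1 dscaleDr dscaleDl.

Lemma dvalZ a (y : dualm) u : dval (a *: y) u = dval y (lact P a u).
Proof. exact: dscaleE. Qed.

End Dual.

(** The transpose of the pairing of [F] with the dual of [P] given by the rank one
    maps, followed by a functional. *)
Section HomDual.
Variables (P F : lmodType A^c) (E : lmodType k) (phi : {linear homm P F -> E}).

Lemma hom_dual_linear : linear (fun x : F => dmk (phi \o rk1 P x) : dualm P E).
Proof.
move=> a x z; apply: dval_inj => u; rewrite dvalD dvalZ !dmkK /= -linearD; congr (phi _).
apply: hval_inj => p; rewrite -[rk1 P x _]scale1r hvalP !rk1E scl1 scale1r lactE.
by rewrite scalerDr scalerA.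
Qed.
Definition hom_dual : {linear F -> dualm P E} := mklin hom_dual_linear.
Lemma hom_dualE x u : dval (hom_dual x) u = phi (rk1 P x u).
Proof. by rewrite /hom_dual mklinE dmkK. Qed.
End HomDual.

Section DualMap.
Variables (P Q : lmodType A^c) (E : lmodType k) (d : {linear Q -> P}).

Lemma dual_map_linear : linear (fun y : dualm Q E => dmk (dval y \o precomp Lam d) : dualm P E).
Proof.
move=> a y z; apply: dval_inj => u.
rewrite dvalD dvalZ !dmkK /= dvalD dvalZ; congr (dval y _ + _).
by apply: hval_inj => q; rewrite lactE !precompE lactE.
Qed.
Definition dual_map : {linear dualm Q E -> dualm P E} := mklin dual_map_linear.
Lemma dual_mapE y u : dval (dual_map y) u = dval y (precomp Lam d u).
Proof. by rewrite /dual_map mklinE dmkK. Qed.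

Lemma dual_map_hom F (phi : {linear homm Q F -> E}) x :
  dual_map (hom_dual phi x) = hom_dual (phi \o precomp F d) x.
Proof.
apply: dval_inj => u; rewrite dual_mapE !hom_dualE /=; congr (phi _).
by apply: hval_inj => q; rewrite precompE !rk1E precompE.
Qed.
End DualMap.

End HomFunctors.

Section FreeModules.
Variable R : pzRingType.
Implicit Types V F : lmodType R.

Lemma projective_regular : projective (R^o : lmodType R).
Proof.
move=> X Y g f gs; have [x gx] := gs (f 1).
have hl : linear (fun a : R^o => (a : R) *: x) by move=> a u v; rewrite scalerDl -scalerA.
exists (mklin hl) => a /=; rewrite mklinE linZ gx -linZ; congr (f _).
exact: mulr1.
Qed.

Definition free n : lmodType R := prodm (fun _ : 'I_n => (R^o : lmodType R)).

Lemma fgm_free n : fgm (free n).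
Proof.
pose e i : free n := fun j => if i == j then 1 else 0.
exists (codom e) => v.
have -> : v = \sum_i (v i : R) *: e i.
  apply: prodm_ext => j; rewrite -[RHS]prE linear_sum (bigD1 j) //= big1.
    by rewrite prE addr0 prodmZ /e eqxx -[RHS]/(v j * 1) mulr1.
  by move=> i ij; rewrite prE prodmZ /e (negbTE ij) scaler0.
apply: submod_sum => [|i]; first exact: submod_span.
by apply: submodZ (submod_span _) _; apply: span_mem; apply: codom_f.
Qed.

Section Comb.
Variables (V : lmodType R) (s : seq V).

Lemma comb_linear : linear (fun a : free (size s) => \sum_i (a i : R) *: s`_i).
Proof.
move=> c a b; rewrite scaler_sumr -big_split; apply: eq_bigr => i _ /=.
by rewrite prodmD prodmZ scalerA -scalerDl.
Qed.
Definition comb : {linear free (size s) -> V} := mklin comb_linear.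
Lemma combE a : comb a = \sum_i (a i : R) *: s`_i. Proof. exact: mklinE. Qed.

Lemma span_comb v : span s v -> exists a, comb a = v.
Proof.
suff: span s v -> exists a : nat -> R, \sum_(i < size s) a i *: s`_i = v.
  by move=> H /H[a av]; exists (fun i => a i); rewrite combE.
elim: s v => [v ->|x t IH v [c /IH[a av]]]; first by exists (fun=> 0); rewrite big_ord0.
exists (fun i => if i is j.+1 then a j else c).
by rewrite big_ord_recl /= av addrC subrK.
Qed.
End Comb.
End FreeModules.

Section Duality.
Variables (k : comPzRingType) (A : algType k).
Hypotheses (ark : artin k^o) (fgA : finitely_generated A).
Local Notation Lam := (A^c^o : lmodType A^c).
Implicit Types V W F G P Q : lmodType A^c.

Let nok : noeth k^o := artin_noeth ark.

Lemma noeth_Lam : noeth Lam.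
Proof. exact/noeth_rst/(noeth_fgm nok)/fgm_rst_Lam. Qed.

Lemma artin_Lam : artin Lam.
Proof. exact/artin_rst/(artin_fgm ark)/fgm_rst_Lam. Qed.

(** As [P] is projective, a map from [P] into a finitely generated module is a sum of
    rank one maps; split off one generator at a time. *)
Lemma hom_gen P F (T : homm P F -> Prop) (s : seq F) (w : homm P F) :
  projective P -> submod T -> (forall x u, x \in s -> T (rk1 P x u)) ->
  (forall p, span s (hval w p)) -> T w.
Proof.
move=> projP Ts; elim: s w => [|x s IH] w sT sw.
  suff -> : w = 0 by apply: submod0.
  by apply: hval_inj => p; rewrite (sw p) hval0.
pose Ss := submod_span s.
have bl : linear (fun q : Lam * subm Ss => (q.1 : A^c) *: x + subv q.2).
  move=> c a b; rewrite linP /= scalerDr scalerDl scalerA addrACA.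
  by congr (_ + _); apply: linP.
have [|g gE] := @proj_factor _ _ _ _ (mklin bl) (hval w) projP.
  move=> p; have [a ap] := sw p; exists (a, msub Ss ap).
  by rewrite mklinE msubK /= addrC subrK.
have fl : linear (fun p => (g p).1 : Lam) by move=> c p q; rewrite linP.
pose u := hmk (mklin fl).
rewrite -(subrK (rk1 P x u) w); apply: submodD => //; last first.
  by apply: sT; rewrite mem_head.
apply: IH => [y v ys|p]; first by apply: sT; rewrite inE ys orbT.
rewrite addrC -scaleN1r hvalP rk1E hmkK mklinE -gE mklinE.
suff -> : scl A (-1) *: ((g p).1 *: x) + ((g p).1 *: x + subv (g p).2) = subv (g p).2.
  exact: subvP.
by rewrite /scl scaleN1r scaleN1r addKr.
Qed.

Section HomDuality.
Variables (P F : lmodType A^c) (E : lmodType k).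
Hypotheses (projP : projective P) (fgF : fgm F).

Lemma hom_dual_inj (phi : {linear homm P F -> E}) :
  (forall x, hom_dual phi x = 0) -> forall w, phi w = 0.
Proof.
move=> phi0; have [s sF] := fgF => w; apply: (@hom_gen P F (fun w => phi w = 0) s) => //.
  exact: submod_ker.
by move=> x u _; rewrite -hom_dualE phi0 dval0.
Qed.

(** A map [g] determines a functional [psi] on the maps from [P] to a free cover of
    [F].  The relations of [F] are finitely generated, so the maps from [P] into them
    are sums of rank one maps, and [psi] vanishes on these. *)
Lemma hom_dual_surj (g : {linear F -> dualm P E}) :
  exists phi : {linear homm P F -> E}, forall x, hom_dual phi x = g x.
Proof.
have [s sF] := fgF; pose n := size s; pose pi := comb s.
have psil : linear (fun w : homm P (free A^c n) =>
    \sum_(i < n) dval (g s`_i) (postcomp P (pr _ i) w)).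
  move=> c v w; rewrite scaler_sumr -big_split; apply: eq_bigr => i _ /=.
  by rewrite !linP.
pose psi := mklin psil.
have psiE a u : psi (rk1 P a u) = dval (g (pi a)) u.
  rewrite /psi mklinE combE linear_sum.
  transitivity (\sum_(i < n) dval ((a i : A^c) *: g s`_i) u).
    apply: eq_bigr => i _; rewrite dvalZ; congr (dval _ _).
    by apply: hval_inj => p; rewrite postcompE rk1E prE lactE.
  rewrite dvalE linear_sum -[RHS](prE _ _) linear_sum; apply: eq_bigr => i _.
  by rewrite prE dvalE linZ.
have [||phi phiE] := @factor_surj _ _ _ E (postcomp P pi) psi.
- move=> w; have [|h hE] := @proj_factor _ _ _ _ pi (hval w) projP.
    by move=> p; apply: span_comb.
  by exists (hmk h); apply: hval_inj => p; rewrite postcompE hmkK hE.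
- move=> w w0; have [t tE] := noeth_fgm noeth_Lam (fgm_free _ n) (submod_ker pi).
  apply: (@hom_gen P _ (fun w => psi w = 0) t) => //.
  + exact: submod_ker.
  + by move=> a u /span_mem/tE pa; rewrite psiE pa linear0 dval0.
  by move=> p; apply/tE; rewrite -postcompE w0 hval0.
exists phi => x; have [a <-] := span_comb (sF x); apply: dval_inj => u.
rewrite hom_dualE -psiE -phiE; congr (phi _); apply: hval_inj => p.
by rewrite postcompE !rk1E linZ.
Qed.

End HomDuality.

(** A map from an ideal [K] is a functional on Hom (P, K), which extends to Hom (P, R)
    because [E] is injective. *)
Lemma dualm_injective P (E : lmodType k) :
  projective P -> injective_module E -> injective_module (dualm P E).
Proof.
move=> projP injE; apply: (@baer _ _ (fun=> True)) => [K Ks _ f|]; last first.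
  by move=> V X _ [y ny]; exists y.
have fgK : fgm (subm Ks) by have [s sE] := noeth_Lam Ks; apply: subm_fgm sE.
have [phi phiE] := hom_dual_surj projP fgK f.
have [|phi' phi'E] := inj_factor (a := postcomp P (subv : {linear subm Ks -> Lam})) (f := phi) injE.
  move=> u u0; suff -> : u = 0 by rewrite linear0.
  apply: hval_inj => p; apply: subv_inj.
  by rewrite -postcompE u0 !hval0 linear0.
exists (dmk phi') => x; rewrite -phiE; apply: dval_inj => u.
rewrite hom_dualE dvalZ dmkK -phi'E; congr (phi' _).
by apply: hval_inj => p; rewrite postcompE rk1E lactE linZ.
Qed.

(** The dual of [Lam] is Hom_k (A, E); evaluation at generators of [A] over [k] embeds
    it in a power of [E]. *)
Lemma dualm_fgm (E : lmodType k) : fgm E -> fgm (dualm Lam E).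
Proof.
move=> fgE; apply: fgm_rst.
have [b bA] := fgm_rst_Lam fgA; pose id1 := hmk (idfun : {linear Lam -> Lam}).
have ll i : linear (fun y : rst (dualm Lam E) => dval (y : dualm Lam E) (rk1 Lam (b`_i : Lam) id1)).
  move=> c y z; rewrite dvalD; congr (_ + _); rewrite rstZ dvalZ -linZ; congr (dval _ _).
  apply: hval_inj => p; rewrite lactE -[c *: _]addr0 hvalP hval0 addr0.
  exact: scl_mulr.
have [|||s sE] := @joint_kernel_fg _ (rst (dualm Lam E)) E (size b) (fun i => mklin (ll i)) (fun=> True).
- exact: noeth_fgm nok fgE.
- exact: submodT.
- move=> y _ y0; apply: (@dval_inj _ _ Lam E) => u; rewrite dval0.
  pose T (a : rst Lam) := dval (y : dualm Lam E) (rk1 Lam (a : Lam) id1) = 0.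
  have rk1u : u = rk1 Lam (hval u 1) id1.
    apply: hval_inj => p; rewrite rk1E hmkK /= -linZ; congr (hval u _).
    by rewrite -[RHS]/(1 * (p : A)) mul1r.
  rewrite rk1u; apply: (@span_min _ (rst Lam) T b) (bA _) => [|x xb].
    split=> [|c x z]; rewrite /T.
      by rewrite (_ : rk1 _ _ _ = 0) ?linear0 //; apply: hval_inj => p; rewrite rk1E scaler0 hval0.
    move=> x0 z0; rewrite (_ : rk1 _ _ _ = c *: rk1 Lam (x : Lam) id1 + rk1 Lam (z : Lam) id1).
      by rewrite linP x0 z0 scaler0 addr0.
    apply: hval_inj => p; rewrite hvalP !rk1E rstZ scalerDr !scalerA.
    by rewrite scl_mulr.
  have xlt : (index x b < size b)%N by rewrite index_mem.
  by have := y0 _ xlt; rewrite mklinE nth_index.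
by exists s => y; apply/sE.
Qed.

(** A k-linear map from [V] to [E] is the same as an A-linear map from [V] to the dual
    of [Lam]. *)
Lemma fg_injective_cogenerator_alg V (t : V) : t <> 0 ->
  exists (F : lmodType A^c) (h : {linear V -> F}),
    [/\ injective_module F, fgm F & h t <> 0].
Proof.
move=> t0; have [E [h [injE fgE ht]]] := @fg_injective_cogenerator k ark (rst V) t t0.
have evl : linear (fun w : homm Lam V => h (hval w 1)) by move=> c u v; rewrite hvalP -linP.
exists (dualm Lam E), (hom_dual (mklin evl)); split.
- exact: dualm_injective (@projective_regular _) injE.
- exact: dualm_fgm.
move=> e0; apply: ht; have := hom_dualE (mklin evl) t (hmk (idfun : {linear Lam -> Lam})).
by rewrite e0 dval0 mklinE rk1E hmkK /= scale1r.
Qed.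

End Duality.

(** * Injective modules over an artinian ring *)

Section Noetherian.
Variable R : pzRingType.
Local Notation Reg := (R^o : lmodType R).

(** A map from a finitely generated ideal takes its values in a finite subsum. *)
Lemma injective_dsum (I : choiceType) (V : I -> lmodType R) : noeth Reg ->
  (forall i, injective_module (V i)) -> injective_module (dsum V).
Proof.
move=> noR injV; apply: (@baer _ _ (fun=> True)) => [K Ks _ f|]; last first.
  by move=> W X _ [y ny]; exists y.
have [s sE] := noR _ Ks; have [t tK] := subm_fgm Ks sE.
have [u uP] : exists u : seq I, forall x i, i \notin u -> subv (f x) i = 0.
  have [u ut] : exists u : seq I, forall x i, x \in t -> i \notin u -> subv (f x) i = 0.
    elim: {tK} t => [|x t [u ut]]; first by exists [::].
    have [v vx] := subvP (f x); exists (v ++ u) => y i; rewrite inE mem_cat negb_or.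
    by move=> /orP[/eqP->|yt] /andP[iv iu]; [apply: vx|apply: ut].
  exists u => x i iu; apply: (@span_min _ _ (fun x => subv (f x) i = 0) t) (tK x) => [|y yt].
    split=> [|a y z]; first by rewrite !linear0.
    by rewrite !linP prodmD prodmZ => -> ->; rewrite scaler0 addr0.
  exact: ut.
have H i : exists z : V i, forall x, subv (f x) i = (subv x : R) *: z.
  have [|h hE] := inj_factor (a := (subv : {linear subm Ks -> Reg}))
      (f := pr V i \o subv \o f) (injV i).
    by move=> x x0; rewrite /= (_ : x = 0) ?linear0 //; apply: subv_inj; rewrite x0 linear0.
  exists (h (1 : R^o)) => x; rewrite -linZ -[X in h X]/(subv x * 1 : R) mulr1 hE /=.
  by rewrite prE.
pose z : prodm V := fun i => if i \in u then sval (cid (H i)) else 0.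
have zf : fin_supp z by exists u => i; rewrite /z; case: ifP.
exists (msub (submod_fin_supp V) zf) => x; apply: subv_inj; rewrite linZ msubK.
apply: prodm_ext => i; rewrite prodmZ /z; case: ifPn => iu.
  exact: (svalP (cid (H i))).
by rewrite uP // scaler0.
Qed.

(** Drop ideals from the intersection until it is no longer contained in [M].  For a
    suitable [b] in the remaining intersection and off [M], the ideal of all [a] with
    [a b] in [M] is the last ideal dropped. *)
Lemma maxsub_inter (M : R^o -> Prop) n (K : nat -> R^o -> Prop) : maxsub M ->
  (forall i, (i < n)%N -> maxsub (K i)) ->
  (forall a, (forall i, (i < n)%N -> K i a) -> M a) ->
  exists i b, [/\ (i < n)%N, ~ M b & forall a : R, M (a * b) <-> K i a].
Proof.
move=> [Ms M1 Mm]; elim: n => [|n IH] Km KM; first by case: M1; apply: KM.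
have [H|/existsNP[a /not_implyP[La Ma]]] :=
  pselect (forall a, (forall i, (i < n)%N -> K i a) -> M a).
  have [|i [b [lt_in Mb bE]]] := IH _ H.
    by move=> i lt_in; apply: Km; apply: ltnW.
  by exists i, b; split=> //; apply: ltnW.
have [Ks K1 Kmax] := Km n (ltnSn n).
have KLM (x : R) : K n x -> (forall i, (i < n)%N -> K i x) -> M x.
  move=> Kx Lx; apply: KM => i; rewrite ltnS leq_eqVlt => /orP[/eqP->//|]; exact: Lx.
have Lmul (c x : R) : (forall i, (i < n)%N -> K i x) -> forall i, (i < n)%N -> K i (c * x).
  move=> Lx i lt_in; have [Kis _ _] := Km i (ltnW lt_in).
  exact: (submodZ c Kis (Lx i lt_in)).
have Kmul (c x : R) : K n x -> K n (c * x) by move=> Kx; apply: (submodZ c Ks Kx).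
have Mmul (c x : R) : M x -> M (c * x) by move=> Kx; apply: (submodZ c Ms Kx).
have Ka : ~ K n a by move=> Ka; apply: Ma; apply: KLM.
have [c Kc] := Kmax a Ka; pose b : R := c * a.
have {}Kc : K n ((1 : R) - b) by [].
have Lb i : (i < n)%N -> K i b by apply: Lmul.
have Kb : ~ K n b by move=> Kb; apply: K1; rewrite -(subrK b (1 : R)); apply: (submodD Ks Kc Kb).
have Mb : ~ M b.
  move=> Mb; have [d Kd] := Kmax b Kb; apply: Ma.
  have {}Kd : K n ((1 : R) - d * b) by [].
  have e : (a : R) = (a - (a * d * c) * a) + a * d * b by rewrite /b mulrA subrK.
  rewrite e; apply: (submodD Ms); last exact: Mmul.
  apply: KLM.
    have := Kmul a _ Kd; rewrite mulrBr mulr1 /b.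
    by rewrite !mulrA.
  move=> i lt_in; have [Kis _ _] := Km i (ltnW lt_in).
  exact: (submodB Kis (La i lt_in) (submodZ (a * d * c) Kis (La i lt_in))).
have KbE (x : R) : K n x -> K n (x * b).
  move=> Kx; rewrite -[x * b](subKr x); apply: (submodB Ks Kx).
  by have := Kmul x _ Kc; rewrite mulrBr mulr1.
exists n, b; split=> // x; split=> [Mxb|Kx]; last first.
  by apply: KLM; [apply: KbE|apply: Lmul].
apply: contrapT => nKx; have [d Kd] := Kmax x nKx; apply: Mb.
have {}Kd : K n ((1 : R) - d * x) by [].
rewrite -(subrK (d * (x * b)) b); apply: (submodD Ms); last exact: Mmul.
apply: KLM; first by have := KbE _ Kd; rewrite mulrBl mul1r mulrA.
move=> i lt_in; have [Kis _ _] := Km i (ltnW lt_in).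
exact: (submodB Kis (Lb i lt_in) (Lmul d _ (Lmul x b Lb) i lt_in)).
Qed.

(** By the descending chain condition a finite intersection of maximal ideals is
    contained in all maximal ideals; [maxsub_inter] applies to each of them. *)
Lemma finitely_many_simples : artin Reg -> exists n (K : nat -> R^o -> Prop),
  (forall i, (i < n)%N -> submod (K i)) /\
  forall (V : lmodType R) (X : V -> Prop), submod X -> (exists y, ~ X y) ->
  exists y, ~ X y /\ exists i, (i < n)%N /\ forall a : R, X (a *: y) <-> K i a.
Proof.
move=> arR.
pose Phi (T : R^o -> Prop) := exists n (K : nat -> R^o -> Prop),
  (forall i, (i < n)%N -> maxsub (K i)) /\
  forall a, T a <-> (forall i, (i < n)%N -> K i a).
have [|J [Js [n [K [Km JK]]] Jmin]] := @artin_min _ Reg Phi arR.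
  by exists (fun=> True); split=> //; exists 0%N, (fun _ _ => True).
exists n, K; split=> [i /Km[]//|V X Xs [y0 ny0]].
have [b0 [nb0 Mm]] := artin_simple arR Xs ny0.
set y := b0 *: y0 in nb0 Mm; pose M (a : R^o) := X ((a : R) *: y).
have [Ms _ _] := Mm.
have JM a : (forall i, (i < n)%N -> K i a) -> M a.
  move=> /JK Ja; suff [] : J a /\ M a by [].
  apply: (Jmin (fun a => J a /\ M a)) Ja; last by move=> v [].
    exact: submodI.
  exists n.+1, (fun i => if i is j.+1 then K j else M); split=> [[|i] // /Km//|x].
  split=> [[/JK Kx Mx] [|i] //|H]; first exact: Kx.
  by split; [apply/JK => i lt_in; apply: (H i.+1)|apply: (H 0%N)].
have [i [b [lt_in Mb bE]]] := maxsub_inter Mm Km JM.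
exists ((b : R) *: y); split=> //; exists i; split=> // a.
by rewrite scalerA; apply: bE.
Qed.

Lemma zero_module : exists F : lmodType R, injective_module F /\ fgm F.
Proof.
exists (prodm (fun _ : void => Reg)); split; first by apply: injective_prodm => -[].
by exists [::] => v /=; apply: prodm_ext => -[].
Qed.

End Noetherian.

(** The sum is indexed by the module itself.  Zorn's lemma gives a maximal partial
    embedding among those that use only summands with index in their domain.  A
    simple submodule meeting the domain in 0, generated by [t], could still be sent
    to the summand of index [t], which is not in use.  So the domain is essential,
    and any extension of the partial embedding is injective. *)
Lemma embed_dsum (R : pzRingType) (N : lmodType R) :
  artin (R^o : lmodType R) -> noeth (R^o : lmodType R) ->
  (forall t : N, t <> 0 -> exists (F : lmodType R) (h : {linear N -> F}),
     [/\ injective_module F, fgm F & h t <> 0]) ->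
  exists (F : N -> lmodType R) (h : {linear N -> dsum F}),
    (forall t, injective_module (F t) /\ fgm (F t)) /\ injective h.
Proof.
move=> arR noR cog.
have cog' t : exists F : {F : lmodType R & {linear N -> F}},
    [/\ injective_module (tag F), fgm (tag F) & t <> 0 -> tagged F t <> 0].
  have [->|t0] := eqVneq t 0.
    by have [F [iF fF]] := zero_module R; exists (Tagged (fun F : lmodType R => {linear N -> F}) (\0 : {linear N -> F})).
  have [|F [h [iF fF ht]]] := cog t; first by apply/eqP.
  by exists (Tagged (fun F : lmodType R => {linear N -> F}) h).
have [Fh FhP] := choice cog'; pose F t := tag (Fh t); pose h t : {linear N -> F t} := tagged (Fh t).
have injF t : injective_module (F t) by case: (FhP t).
have fgF t : fgm (F t) by case: (FhP t).
have hn t : t <> 0 -> h t t <> 0 by case: (FhP t).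
pose D := dsum F.
pose Phi (G : N * D -> Prop) := [/\ forall z, G (0, z) -> z = 0,
  forall x, G (x, 0) -> x = 0 &
  forall x z, G (x, z) -> forall t, subv z t <> 0 -> exists z', G (t, z')].
have [||G [Gs [Gf Gi Gsup] _ Gmax]] := @zorn_submod _ (N * D)%type Phi _ (submod00 _).
- split=> [z /(congr1 snd)|x /(congr1 fst)|x z /(congr1 snd) /= -> t] //.
  by rewrite linear0.
- move=> FF _ FP _; split=> [z [S [FS Sz]]|x [S [FS Sx]]|x z [S [FS Sxz]] t zt].
  + by case: (FP S FS) => H _ _; apply: H.
  + by case: (FP S FS) => _ H _; apply: H.
  + by case: (FP S FS) => _ _ H; have [z' Sz'] := H _ _ Sxz t zt; exists z', S.
have ess (y : N) : y <> 0 -> exists a : R, a *: y <> 0 /\ exists z, G (a *: y, z).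
  move=> y0; apply: contrapT => ny.
  have Dy (a : R) z : G (a *: y, z) -> a *: y = 0.
    by move=> Gz; apply: contrapT => ay; apply: ny; exists a; split=> //; exists z.
  have [b [t0 [_ _ tm]]] := artin_simple arR (submod00 N) y0.
  set t := b *: y in t0 tm.
  have Dt (a : R) z : G (a *: t, z) -> a *: t = 0 by rewrite scalerA; apply: Dy.
  pose w : N * D := (t, ind F t (h t t)).
  pose G' p := exists q r, [/\ G q, exists a, r = a *: w & p = q + r].
  have GG' p : G p -> G' p.
    by move=> Gp; exists p, 0; rewrite addr0; split=> //; exists 0; rewrite scale0r.
  have G'w : G' w.
    exists 0, w; rewrite add0r; split=> //; first exact: submod0 Gs.
    by exists 1; rewrite scale1r.
  suff : G w by move=> Gw; apply: t0; rewrite -[t]scale1r; apply: Dt; rewrite scale1r; apply: Gw.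
  apply: (Gmax G') => //; first by apply: submodDs => //; apply: submod_cyc.
  split.
  - move=> z [[u v] [_ [Guv [a ->] [e ->]]]].
    have at0 : a *: t = 0.
      apply: (Dt a (- v)); have -> : a *: t = - u by apply/eqP; rewrite -addr_eq0 addrC -e.
      by have := submodN Gs Guv.
    have u0 : u = 0 by move: e; rewrite at0 addr0.
    have := Guv; rewrite u0 => /Gf ->.
    by rewrite add0r -(linZ (ind F t)) -linZ at0 !linear0.
  - move=> x [[u v] [_ [Guv [a ->] E]]].
    have e : 0 = v + a *: ind F t (h t t) := congr1 snd E.
    have -> : x = u + a *: t := congr1 fst E.
    have vt : subv v t = 0.
      apply: contrapT => vt; have [z' Gz'] := Gsup _ _ Guv t vt.
      by apply: t0; rewrite -[t]scale1r; apply: Dt; rewrite scale1r; apply: Gz'.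
    have aht : a *: h t t = 0.
      have := congr1 (fun d : D => subv d t) e; rewrite linear0 linearD prodmD vt add0r.
      by rewrite linZ prodmZ ind_in => <-.
    have at0 : a *: t = 0.
      apply: contrapT => nat; have [c] := tm a nat; rewrite scalerBl scale1r => /subr0_eq ct.
      by apply: (hn t t0); rewrite [X in h t X]ct linZ -[c *: _]/(c * (a : R)) -scalerA aht scaler0.
    have v0 : v = 0 by rewrite -[v]addr0 [RHS]e; congr (_ + _); rewrite -(linZ (ind F t)) aht linear0.
    by move: Guv; rewrite v0 => /Gi ->; rewrite add0r.
  move=> x z [[u v] [_ [Guv [a ->] [_ ->]]]] i; have [->|ti] := eqVneq i t.
    by move=> _; eexists; apply: G'w.
  rewrite linearD prodmD linZ prodmZ ind_out // scaler0 addr0 => vi.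
  by have [z' Gz'] := Gsup _ _ Guv i vi; exists z'; apply: GG'.
have l1 : linear (fun p : subm Gs => (subv p).1) by move=> a p q; rewrite linP.
have l2 : linear (fun p : subm Gs => (subv p).2) by move=> a p q; rewrite linP.
have [|g gE] := inj_factor (a := mklin l1) (f := mklin l2) (injective_dsum noR injF).
  by move=> p; rewrite !mklinE; have := subvP p; case: (subv p) => x z /= Gxz x0;
    apply: Gf; rewrite -x0.
exists F, g; split=> //; apply: linear_inj0 => x gx; apply: contrapT => x0.
have [a [ax [z Gz]]] := ess x x0; apply: ax; apply: Gi.
have := gE (msub Gs Gz); rewrite !mklinE msubK /= linZ gx scaler0 => z0.
by move: Gz; rewrite -z0.
Qed.

(** * Projective resolutions and Ext *)

Section Resolutions.
Variable R : pzRingType.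
Implicit Types M N X Y Z K C : lmodType R.

Lemma exact_im X Y Z (f : {linear X -> Y}) (g : {linear Y -> Z}) x :
  exact_at f g -> g (f x) = 0.
Proof. by move=> fg; apply: (proj2 (fg _)); exists x. Qed.

Lemma exact_ker X Y Z (f : {linear X -> Y}) (g : {linear Y -> Z}) y :
  exact_at f g -> g y = 0 -> exists x, f x = y.
Proof. by move=> fg; apply: (proj1 (fg _)). Qed.

Section Comparison.
Variables (M : lmodType R) (P P' : proj_resolution M).
Local Notation d := (res_diff P).
Local Notation d' := (res_diff P').

Lemma res_dd n x : d n (d n.+1 x) = 0.
Proof. exact: exact_im (@res_exact _ _ P n). Qed.

Lemma res_augd x : res_aug P (d 0%N x) = 0.
Proof. exact: exact_im (@res_aug_exact _ _ P). Qed.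

(* Two consecutive components: what the next one is built from. *)
Let comm_pair n := {f : {linear res_obj P n -> res_obj P' n} *
    {linear res_obj P n.+1 -> res_obj P' n.+1} | forall x, d' n (f.2 x) = f.1 (d n x)}.

Lemma chain_map_exists : exists f : forall n, {linear res_obj P n -> res_obj P' n},
  (forall x, res_aug P' (f 0%N x) = res_aug P x) /\
  (forall n x, d' n (f n.+1 x) = f n (d n x)).
Proof.
have [|f0 f0E] := proj_factor (b := res_aug P') (f := res_aug P) (@res_projective _ _ P 0).
  by move=> x; apply: res_aug_surj.
have [|f1 f1E] := proj_factor (b := d' 0%N) (f := f0 \o d 0%N) (@res_projective _ _ P 1).
  by move=> x; apply: (exact_ker (@res_aug_exact _ _ _)); rewrite /= f0E res_augd.
have step n (s : comm_pair n) : {t : comm_pair n.+1 | (sval t).1 = (sval s).2}.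
  case: s => -[g h] /= gh; apply: cid.
  have [|h' h'E] := proj_factor (b := d' n.+1) (f := h \o d n.+1) (@res_projective _ _ P n.+2).
    by move=> x; apply: (exact_ker (@res_exact _ _ _ _)); rewrite /= gh res_dd linear0.
  by exists (exist _ (h, h') h'E).
pose s := fix s n : comm_pair n :=
  if n is m.+1 then sval (step m (s m)) else exist _ (f0, f1) f1E.
exists (fun n => (sval (s n)).1); split=> // n x.
by rewrite [X in (sval X).1]/s -/s (svalP (step n (s n))) (svalP (s n)).
Qed.

End Comparison.

Lemma homotopy_exists M (P : proj_resolution M)
    (e : forall n, {linear res_obj P n -> res_obj P n}) :
  (forall x, res_aug P (e 0%N x) = res_aug P x) ->
  (forall n x, res_diff P n (e n.+1 x) = e n (res_diff P n x)) ->
  forall n, exists (h : {linear res_obj P n -> res_obj P n.+1})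
    (h' : {linear res_obj P n.+1 -> res_obj P n.+2}),
    forall x, e n.+1 x - x = res_diff P n.+1 (h' x) + h (res_diff P n x).
Proof.
move=> e0 ed.
have next n (h : {linear res_obj P n -> res_obj P n.+1}) :
    (forall x, res_diff P n (e n.+1 x - x - h (res_diff P n x)) = 0) ->
    exists h' : {linear res_obj P n.+1 -> res_obj P n.+2},
    forall x, e n.+1 x - x = res_diff P n.+1 (h' x) + h (res_diff P n x).
  move=> H.
  pose f : {linear _ -> _} := e n.+1 \- idfun \- (h \o res_diff P n).
  have [|h' h'E] := proj_factor (b := res_diff P n.+1) (f := f) (@res_projective _ _ P n.+1).
    by move=> x; apply: (exact_ker (@res_exact _ _ _ _)); apply: H.
  by exists h' => x; rewrite h'E /= subrK.
elim=> [|n [h [h' hh']]].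
  pose f : {linear _ -> _} := e 0%N \- idfun.
  have [|h hE] := proj_factor (b := res_diff P 0%N) (f := f) (@res_projective _ _ P 0).
    by move=> x; apply: (exact_ker (@res_aug_exact _ _ _)); rewrite linearB e0 subrr.
  exists h; apply: next => x.
  by rewrite !linearB ed hE subrr.
exists h'; apply: next => x; rewrite !linearB ed.
have := hh' (res_diff P n.+1 x); rewrite res_dd linear0 addr0 => ->.
exact: subrr.
Qed.

(** Carry a cocycle to the other resolution, where it is a coboundary, and back: the
    round trip is homotopic to the identity. *)
Lemma ext_any_resolution M N n (P : proj_resolution M) :
  ext_vanishes n.+1 M N -> hom_to_exact_at (res_diff P n.+1) (res_diff P n) N.
Proof.
move=> [P' exP'] u; split=> [ud|[v vE] x]; last by rewrite vE /= res_dd linear0.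
have [f [f0 fd]] := chain_map_exists P P'; have [g [g0 gd]] := chain_map_exists P' P.
have [v' v'E] : exists v' : {linear res_obj P' n -> N}, u \o g n.+1 =1 v' \o res_diff P' n.
  by apply/(exP' (u \o g n.+1)) => x; rewrite /= -gd ud.
have [||h [h' hh']] := @homotopy_exists M P (fun i => g i \o f i) _ _ n.
- by move=> x; rewrite /= g0 f0.
- by move=> i x; rewrite /= gd fd.
exists ((v' \o f n) \- (u \o h) : {linear _ -> _}) => x; rewrite /= -fd.
have /= <- := v'E (f n.+1 x).
have := congr1 u (hh' x); rewrite /= linearB linearD ud add0r => <-.
by rewrite subKr.
Qed.

(** Lift [f] on the first projective of the resolution; the failure of the lift to
    vanish on the syzygy is a cocycle with values in [K]. *)
Lemma ext1_lift X K (E : lmodType R) C (i : {linear K -> E}) (p : {linear E -> C}) (f : {linear X -> C}) :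
  ext_vanishes 1 X K -> injective i -> (forall y, p y = 0 <-> exists z, i z = y) ->
  (forall x, exists y, p y = f x) ->
  exists g : {linear X -> E}, forall x, p (g x) = f x.
Proof.
move=> [P exP] iinj pK fp.
have [|a aE] := proj_factor (b := p) (f := f \o res_aug P) (@res_projective _ _ P 0).
  by move=> x; apply: fp.
have [|b bE] := @factor_inj _ _ _ _ i (a \o res_diff P 0%N) iinj.
  by move=> x; apply/pK; rewrite /= aE /= res_augd linear0.
have [v vE] : exists v : {linear res_obj P 0 -> K}, b =1 v \o res_diff P 0%N.
  by apply/exP => x; apply: iinj; rewrite bE /= res_dd !linear0.
have [||g gE] := @factor_surj _ _ _ _ (res_aug P) (a \- (i \o v) : {linear _ -> _}).
- exact: res_aug_surj.
- by move=> x /(exact_ker (@res_aug_exact _ _ P))[y <-]; have /= := vE y; rewrite /= => <-; rewrite bE subrr.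
exists g => x; have [y <-] := res_aug_surj P x.
rewrite gE /= linearB aE /=; suff -> : p (i (v y)) = 0 by rewrite subr0.
by apply/pK; exists (v y).
Qed.

End Resolutions.

(** * Split sequences and orthogonality to Gorenstein projective modules *)

Section Splitting.
Variable R : pzRingType.
Implicit Types K E C : lmodType R.

Lemma split_injective_kernel K E C (i : {linear K -> E}) (p : {linear E -> C}) :
  injective_module K -> injective i -> surjective_map p ->
  (forall y, p y = 0 <-> exists z, i z = y) ->
  exists s : {linear C -> E}, forall x, p (s x) = x.
Proof.
move=> injK iinj psurj pK.
have [r rE] := injK _ _ i (idfun : {linear K -> K}) iinj.
have [|s sE] := @factor_surj _ _ _ _ p (idfun \- (i \o r) : {linear E -> E}) psurj.
  by move=> y /pK[z <-]; have /= := rE z => /= ->; rewrite subrr.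
exists s => x; have [y <-] := psurj x; rewrite sE linearB /=.
have -> : p (i (r y)) = 0 by apply/pK; exists (r y).
exact: subr0.
Qed.

Lemma fin_supp_natP (Y : nat -> lmodType R) (w : prodm Y) :
  fin_supp w <-> exists N, forall n, (N <= n)%N -> w n = 0.
Proof.
split=> [[s ws]|[N wN]].
  exists (\max_(i <- s) i).+1 => n ltn; apply: ws; apply: contraTN ltn => ns.
  by rewrite -leqNgt; apply: (@leq_bigmax_seq _ s xpredT id n ns).
by exists (iota 0 N) => n; rewrite mem_iota /= add0n -leqNgt => /wN.
Qed.

Lemma fgm_unif_supp (F : lmodType R) (Y : nat -> lmodType R) (t : {linear F -> prodm Y}) :
  fgm F -> (forall x, fin_supp (t x)) -> exists N, forall x n, (N <= n)%N -> t x n = 0.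
Proof.
move=> [s sF] tf.
have [N NP] : exists N, forall x n, x \in s -> (N <= n)%N -> t x n = 0.
  elim: s {sF} => [|y s [N NP]]; first by exists 0%N.
  have /fin_supp_natP[N' N'P] := tf y; exists (maxn N' N) => x n.
  rewrite inE geq_max => /orP[/eqP->|xs] /andP[N'n Nn]; first exact: N'P.
  exact: NP.
exists N => x n Nn; apply: (@span_min _ _ (fun x => t x n = 0) s) (sF x) => [|y ys].
  split=> [|a y z]; first by rewrite linear0.
  by rewrite linP prodmD prodmZ => -> ->; rewrite scaler0 addr0.
exact: NP.
Qed.

End Splitting.

Section HomTo.
Variables (R : pzRingType) (P : int -> lmodType R).
Variable d : forall i : int, {linear P (i + 1) -> P i}.
Hypotheses (projP : forall i, projective (P i)).
Hypotheses (exP : forall i, exact_at (d (i + 1)) (d i)).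

Definition hom_to_exact (N : lmodType R) : Prop :=
  forall i, hom_to_exact_at (d (i + 1)) (d i) N.

Let dd i x : d i (d (i + 1) x) = 0. Proof. exact: (exact_im _ (@exP i)). Qed.

Lemma hom_to_exact_injective I : injective_module I -> hom_to_exact I.
Proof.
move=> injI i u; split=> [ud|[v vE] x]; last by rewrite vE /= dd linear0.
have [|v vE] := @inj_factor _ _ _ _ (d i) u injI.
  by move=> x /(exact_ker (@exP i))[y <-].
by exists v => x; rewrite /= vE.
Qed.

(** Dimension shifting: a cocycle with values in [K] bounds in [I], and its primitive
    composed with [p] is a cocycle with values in [C], one degree lower. *)
Lemma hom_to_exact_kernel (K I C : lmodType R) (j : {linear K -> I}) (p : {linear I -> C}) :
  injective_module I -> injective j -> surjective_map p ->
  (forall y, p y = 0 <-> exists z, j z = y) -> hom_to_exact C -> hom_to_exact K.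
Proof.
move=> injI jinj psurj pK exC i u; split=> [ud|[v vE] x]; last by rewrite vE /= dd linear0.
have [n ei] : exists n, i = n + 1 by exists (i - 1); rewrite subrK.
subst i.
have [v vE] : exists v : {linear P (n + 1) -> I}, j \o u =1 v \o d (n + 1).
  by apply/(hom_to_exact_injective injI) => x; rewrite /= ud linear0.
have [w wE] : exists w : {linear P n -> C}, p \o v =1 w \o d n.
  apply/(exC n) => x /=; have /= <- := vE x; apply/pK; by exists (u x).
have [|w' w'E] := @proj_factor _ _ _ _ p w (@projP n); first by move=> x; apply: psurj.
have [|v' v'E] := @factor_inj _ _ _ _ j (v \- (w' \o d n) : {linear P (n + 1) -> I}) jinj.
  by move=> x; apply/pK; rewrite /= linearB w'E; have /= -> := wE x; rewrite subrr.
exists v' => x; apply: jinj; rewrite /= v'E /= dd linear0 subr0.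
exact: vE.
Qed.

Lemma hom_to_exact_prod (I : Type) (Z : I -> lmodType R) :
  (forall i, hom_to_exact (Z i)) -> hom_to_exact (prodm Z).
Proof.
move=> exZ i u; split=> [ud|[v vE] x]; last by rewrite vE /= dd linear0.
have H t : exists v : {linear P i -> Z t}, pr Z t \o u =1 v \o d i.
  by apply/(exZ t i) => x; rewrite /= ud linear0.
exists (tuplem (fun t => sval (cid (H t)))) => x; apply: prodm_ext => t.
by rewrite /= tuplemE -prE; apply: (svalP (cid (H t))).
Qed.

End HomTo.

(** The left half of a complete projective resolution resolves its module.  The
    indices are iterated successors, so that no transport between types is needed. *)
Lemma gp_ext1 (R : pzRingType) (G N : lmodType R) :
  (forall (P : int -> lmodType R) (d : forall i : int, {linear P (i + 1) -> P i}),
    (forall i, projective (P i)) -> (forall i, exact_at (d (i + 1)) (d i)) ->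
    hom_to_exact d N) ->
  gorenstein_projective G -> ext_vanishes 1 G N.
Proof.
move=> exN [P [d [projP exP _ [iota [iinj imE]]]]].
pose idx := fix idx n : int := if n is m.+1 then idx m + 1 else -1 + 1.
have [|aug augE] := @factor_inj _ _ _ _ iota (d (-1)) iinj.
  by move=> x; apply/imE; exists x.
have aug_surj : surjective_map aug.
  move=> m; have /imE[x xE] : exists m', iota m' = iota m by exists m.
  by exists x; apply: iinj; rewrite augE.
have aug_ex : exact_at (d (-1 + 1)) aug.
  move=> x; rewrite -(exP (-1) x) -augE; split=> [->|e]; first exact: linear0.
  by apply: iinj; rewrite e linear0.
pose res := @ProjResolution R G (fun n => P (idx n)) (fun n => d (idx n)) aug
  (fun n => projP (idx n)) aug_surj aug_ex (fun n => exP (idx n)).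
by exists res; apply: exN.
Qed.

(** * The periodic complex of a reduced product *)

Section ReducedProduct.
Variables (R : pzRingType) (Y : nat -> lmodType R).
Variable dY : forall n, {linear Y n.+1 -> Y n}.
Local Notation W := (prodm Y).

Definition shiftd : {linear W -> W} := tuplem (fun n => dY n \o pr Y n.+1).
Lemma shiftdE w n : shiftd w n = dY n (w n.+1).
Proof. by rewrite /shiftd tuplemE /= prE. Qed.

(** The direct sum is injective, hence a summand of the product, and so is the
    quotient; [s] is a section of the projection. *)
Lemma reduced_product_exists : noeth (R^o : lmodType R) ->
  (forall n, injective_module (Y n)) ->
  exists (V : lmodType R) (p : {linear W -> V}) (s : {linear V -> W}) (dV : {linear V -> V}),
    [/\ injective_module V, forall v, p (s v) = v, forall w, p w = 0 <-> fin_supp w &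
        forall w, dV (p w) = p (shiftd w)].
Proof.
move=> noR injY.
have [V [p [psurj pK]]] := quotient_exists (submod_fin_supp Y).
have pK' w : p w = 0 <-> exists z : dsum Y, subv z = w.
  rewrite pK; split=> [fw|[z <-]]; last exact: subvP.
  by exists (msub (submod_fin_supp Y) fw); rewrite msubK.
have [s sE] := split_injective_kernel (injective_dsum noR injY) (@subv_inj _ _ _ _) psurj pK'.
have [|dV dVE] := @factor_surj _ _ _ _ p (p \o shiftd) psurj.
  move=> w /pK/fin_supp_natP[N wN]; apply/pK/fin_supp_natP; exists N => n Nn.
  by rewrite shiftdE wN ?linear0 // leqW.
exists V, p, s, dV; split=> //; apply: injective_retract (injective_prodm injY) sE.
Qed.

End ReducedProduct.

Section Periodic.
Variables (R : pzRingType) (Y : nat -> lmodType R).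
Variable dY : forall n, {linear Y n.+1 -> Y n}.
Local Notation W := (prodm Y).
Local Notation delta := (shiftd dY).
Variables (V : lmodType R) (p : {linear W -> V}) (s : {linear V -> W}) (dV : {linear V -> V}).

Hypothesis injY : forall n, injective_module (Y n).
Hypothesis dY_surj : surjective_map (dY 0).
Hypothesis dY_exact : forall n, exact_at (dY n.+1) (dY n).
Hypothesis fg_exact : forall F : lmodType R, injective_module F -> fgm F ->
  forall n (g : {linear F -> Y n.+1}), (forall x, dY n (g x) = 0) ->
  exists g' : {linear F -> Y n.+2}, forall x, dY n.+1 (g' x) = g x.
Hypothesis embed : forall N : lmodType R,
  exists (F : N -> lmodType R) (h : {linear N -> dsum F}),
    (forall t, injective_module (F t) /\ fgm (F t)) /\ injective h.
Hypothesis injV : injective_module V.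
Hypothesis psK : forall v, p (s v) = v.
Hypothesis p0 : forall w, p w = 0 <-> fin_supp w.
Hypothesis dVE : forall w, dV (p w) = p (delta w).

Lemma p_eq w w' : (exists N, forall n, (N <= n)%N -> w n = w' n) -> p w = p w'.
Proof.
move=> [N wN]; apply/subr0_eq; rewrite -linearB; apply/p0/fin_supp_natP.
by exists N => n /wN e; rewrite prodmD prodmN e subrr.
Qed.

Lemma dVdV v : dV (dV v) = 0.
Proof.
rewrite -(psK v) !dVE; rewrite (_ : delta _ = 0) ?linear0 //.
by apply: prodm_ext => n; rewrite !shiftdE; apply: exact_im (@dY_exact n).
Qed.

(** A cycle of [V] has almost all its components in the image of [dY]; the others may
    be replaced by 0. *)
Lemma dV_exact : exact_at dV dV.
Proof.
move=> v; split=> [dv|[v' <-]]; last exact: dVdV.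
have /p0/fin_supp_natP[N wN] : p (delta (s v)) = 0 by rewrite -dVE psK.
have H n : exists y : Y n.+1, (N < n)%N -> dY n y = s v n.
  case: n => [|n]; first by exists 0.
  have [Nn|nN] := boolP (N <= n)%N; last by exists 0; rewrite ltnS (negbTE nN).
  have [|y yE] := exact_ker (y := s v n.+1) (@dY_exact n); first by rewrite -shiftdE wN.
  by exists y.
pose w' : W := fun n => if n is m.+1 then sval (cid (H m)) else 0.
exists (p w'); rewrite dVE -[RHS]psK; apply: p_eq; exists N.+1 => n Nn.
by rewrite shiftdE /=; apply: (svalP (cid (H n))).
Qed.

Definition hom_from_exact (X : lmodType R) : Prop :=
  forall f : {linear X -> V}, (forall x, dV (f x) = 0) ->
  exists g : {linear X -> V}, forall x, dV (g x) = f x.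

(** As [F] is finitely generated, a map to [V] killed by [dV] is given by maps to the
    [Y n], of which almost all are killed by [dY]. *)
Lemma hfe_fg F : injective_module F -> fgm F -> hom_from_exact F.
Proof.
move=> injF fgF f df; pose g : {linear F -> W} := s \o f.
have gf x : p (g x) = f x by rewrite /g /= psK.
have [|N NP] := fgm_unif_supp (t := delta \o g : {linear F -> W}) fgF.
  by move=> x; apply/p0; rewrite /= -dVE gf df.
have H n : exists h : {linear F -> Y n.+1}, (N < n)%N -> forall x, dY n (h x) = g x n.
  case: n => [|n]; first by exists (\0 : {linear F -> Y 1}).
  have [Nn|nN] := boolP (N <= n)%N; last first.
    by exists (\0 : {linear F -> Y n.+2}); rewrite ltnS (negbTE nN).
  have [x|h hE] := fg_exact injF fgF (g := pr Y n.+1 \o g : {linear F -> Y n.+1}).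
    by have := NP x n Nn; rewrite /= shiftdE prE.
  by exists h => _ x; rewrite hE /= prE.
pose h n : {linear F -> Y n} :=
  match n with 0%N => \0 | m.+1 => sval (cid (H m)) end.
exists (p \o tuplem h : {linear F -> V}) => x; rewrite /= dVE -gf; apply: p_eq.
exists N.+1 => n Nn; rewrite shiftdE tuplemE.
exact: (svalP (cid (H n))).
Qed.

Lemma hfe_dsum (I : choiceType) (F : I -> lmodType R) :
  (forall i, hom_from_exact (F i)) -> hom_from_exact (dsum F).
Proof.
move=> hF f df.
have H i : exists g : {linear F i -> V}, forall x, dV (g x) = f (ind F i x).
  by apply: (hF i (f \o ind F i : {linear F i -> V})) => x; apply: df.
have [h hE] := dsum_lift (fun i => sval (cid (H i))).
exists h; apply: (dsum_lin_ext (f := dV \o h : {linear dsum F -> V})) => i x.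
by rewrite /= hE; apply: (svalP (cid (H i))).
Qed.

Lemma hfe_injective I : injective_module I -> hom_from_exact I.
Proof.
move=> injI f df; have [F [h [FP hinj]]] := embed I.
have [r rE] := injI _ _ h (idfun : {linear I -> I}) hinj.
have hd : hom_from_exact (dsum F) by apply: hfe_dsum => t; case: (FP t); apply: hfe_fg.
have [|g gE] := hd (f \o r : {linear dsum F -> V}); first by move=> x; apply: df.
exists (g \o h : {linear I -> V}) => x; rewrite /= gE /=.
by have /= -> := rE x.
Qed.

Section Sequence.
Variables (X' X X'' : lmodType R) (i : {linear X' -> X}) (q : {linear X -> X''}).
Hypotheses (iinj : injective i) (qsurj : surjective_map q).
Hypothesis qK : forall x, q x = 0 <-> exists z, i z = x.

Let qi z : q (i z) = 0. Proof. by apply/qK; exists z. Qed.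

Lemma hfe_kernel : hom_from_exact X -> hom_from_exact X'' -> hom_from_exact X'.
Proof.
move=> hX hX'' f df; have [f1 f1E] := injV f iinj.
have [|f2 f2E] := @factor_surj _ _ _ _ q (dV \o f1) qsurj.
  by move=> x /qK[z <-]; rewrite /=; have /= -> := f1E z; apply: df.
have [|g2 g2E] := hX'' f2.
  by move=> x''; have [x <-] := qsurj x''; rewrite f2E /= dVdV.
have [|g1 g1E] := hX (f1 \- (g2 \o q) : {linear X -> V}).
  by move=> x; rewrite /= linearB g2E f2E /= subrr.
exists (g1 \o i : {linear X' -> V}) => z; rewrite /= g1E /= qi linear0 subr0.
exact: (f1E z).
Qed.

Lemma hfe_cokernel : hom_from_exact X' -> hom_from_exact X -> hom_from_exact X''.
Proof.
move=> hX' hX f df.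
have [|g gE] := hX (f \o q : {linear X -> V}); first by move=> x; apply: df.
have [|h hE] := hX' (g \o i : {linear X' -> V}).
  by move=> z; rewrite /= gE /= qi linear0.
have [h1 h1E] := injV h iinj.
have [|g'' g''E] := @factor_surj _ _ _ _ q (g \- (dV \o h1) : {linear X -> V}) qsurj.
  by move=> x /qK[z <-]; rewrite /=; have /= -> := h1E z; rewrite hE subrr.
exists g'' => x''; have [x <-] := qsurj x''.
by rewrite g''E /= linearB dVdV subr0 gE.
Qed.

End Sequence.

(** The cycles of the complex that continues [Y] by 0: all of [Y 0] in degree 0. *)
Definition Z n : lmodType R :=
  match n with 0%N => Y 0 | m.+1 => subm (submod_ker (dY m)) end.
Definition iZ n : {linear Z n -> Y n} :=
  match n return {linear Z n -> Y n} with 0%N => idfun | m.+1 => subv end.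

Lemma iZ_inj n : injective (iZ n).
Proof. by case: n => [|n] //; apply: subv_inj. Qed.

Lemma pZ_exists n : exists q : {linear Y n.+1 -> Z n},
  surjective_map q /\ forall y, iZ n (q y) = dY n y.
Proof.
have [|q qE] := @factor_inj _ _ _ _ (iZ n) (dY n) (@iZ_inj n).
  case: n => [|n] y; first by exists (dY 0 y).
  have dy : dY n (dY n.+1 y) = 0 by apply: exact_im (@dY_exact n).
  by exists (msub (submod_ker (dY n)) dy); rewrite /= msubK.
exists q; split=> // z; suff [y yE] : exists y, dY n y = iZ n z.
  by exists y; apply: (@iZ_inj n); rewrite qE.
case: n {q qE} z => [|n] z; first exact: dY_surj.
exact: exact_ker (@dY_exact n) (subvP z).
Qed.

Let pZ n := sval (cid (pZ_exists n)).
Let pZ_surj n : surjective_map (pZ n). Proof. by case: (svalP (cid (pZ_exists n))). Qed.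
Let pZE n y : iZ n (pZ n y) = dY n y. Proof. by case: (svalP (cid (pZ_exists n))). Qed.
Let pZK n y : pZ n y = 0 <-> exists z, iZ n.+1 z = y.
Proof.
split=> [py|[z <-]]; last by apply: (@iZ_inj n); rewrite pZE linear0; apply: (subvP z).
have dy : dY n y = 0 by rewrite -pZE py linear0.
by exists (msub (submod_ker (dY n)) dy); rewrite /= msubK.
Qed.

Lemma hfe_Z n : hom_from_exact (Z n).
Proof.
elim: n => [|n IH]; first exact: hfe_injective (@injY 0).
exact: hfe_kernel (@iZ_inj n.+1) (@pZ_surj n) (@pZK n) (hfe_injective (@injY n.+1)) IH.
Qed.

Lemma hom_to_exact_Z (P : int -> lmodType R) (d : forall i : int, {linear P (i + 1) -> P i}) n :
  (forall i, projective (P i)) -> (forall i, exact_at (d (i + 1)) (d i)) ->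
  hom_to_exact d (Z n).
Proof.
move=> projP exP; elim: n => [|n IH]; first exact: hom_to_exact_injective (@injY 0).
exact: hom_to_exact_kernel projP exP _ _ _ _ _ (@injY n.+1) (@iZ_inj n.+1) (@pZ_surj n) (@pZK n) IH.
Qed.

(** Each [Z n] has finite injective dimension. *)
Lemma prodZ_gp_perp : right_perp (@gorenstein_projective R) (prodm Z).
Proof.
move=> G; apply: gp_ext1 => P d projP exP.
by apply: hom_to_exact_prod => // n; apply: hom_to_exact_Z.
Qed.

Local Notation Q := (subm (submod_ker dV)).

Lemma Q_gi : gorenstein_injective Q.
Proof.
exists (fun=> V), (fun=> dV); split.
- by move=> _; apply: injV.
- by move=> _; apply: dV_exact.
- move=> I injI _ u; split=> [du|[v vE] x]; last by rewrite vE /= dVdV.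
  by have [v vE] := hfe_injective injI du; exists v => x; rewrite /= vE.
exists subv; split; first exact: subv_inj.
move=> y; split=> [[z <-]|[x <-]]; first exact: exact_ker dV_exact (subvP z).
by exists (msub (submod_ker dV) (dVdV x)); rewrite msubK.
Qed.

Let subvQ (v : V) : dV v = 0 <-> exists z : Q, subv z = v.
Proof.
split=> [dv|[z <-]]; last exact: (subvP z).
by exists (msub (submod_ker dV) dv); rewrite msubK.
Qed.

Hypothesis vg : forall X : lmodType R,
  right_perp (@gorenstein_projective R) X <-> left_perp (@gorenstein_injective R) X.

(** The product is orthogonal to [Q], which is the kernel of the extension of [Q] by [Q]
    given by [dV]. *)
Lemma hfe_prodZ : hom_from_exact (prodm Z).
Proof.
move=> f df; apply: (ext1_lift (i := (subv : {linear Q -> V}))).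
- exact: (proj1 (vg _) prodZ_gp_perp _ Q_gi).
- exact: subv_inj.
- exact: subvQ.
- by move=> x; apply: exact_ker dV_exact (df x).
Qed.

Definition iprodZ : {linear prodm Z -> W} := tuplem (fun n => iZ n \o pr Z n).
Lemma iprodZE z n : iprodZ z n = iZ n (z n).
Proof. by rewrite /iprodZ tuplemE /= prE. Qed.

Lemma prodZ_to_Q : exists q : {linear prodm Z -> Q},
  surjective_map q /\ forall z, subv (q z) = p (iprodZ z).
Proof.
have [|q qE] := @factor_inj _ _ _ _ (subv : {linear Q -> V}) (p \o iprodZ) (@subv_inj _ _ _ _).
  move=> z; apply/subvQ; rewrite /= dVE (_ : delta _ = 0) ?linear0 //.
  by apply: prodm_ext => n; rewrite shiftdE iprodZE; apply: (subvP (z n.+1)).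
exists q; split=> // x; have [v vE] := exact_ker dV_exact (subvP x).
exists (fun n => pZ n (s v n.+1)); apply: subv_inj.
rewrite qE -vE -[in RHS](psK v) dVE /=; congr (p _); apply: prodm_ext => n.
by rewrite iprodZE pZE shiftdE.
Qed.

(** Hom from the direct sum and, by virtual Gorensteinness, Hom from the product of
    the [Z n] keep the periodic complex exact; so does Hom from their quotient [Q].
    The inclusion of [Q] is a cycle in this last complex. *)
Lemma Q_lift : exists t : {linear Q -> V}, forall x, dV (t x) = subv x.
Proof.
have [q [qsurj qE]] := prodZ_to_Q.
have qK z : q z = 0 <-> exists x : dsum Z, subv x = z.
  transitivity (fin_supp z).
    transitivity (p (iprodZ z) = 0).
      by rewrite -qE; split=> [->|e]; [exact: linear0|apply: subv_inj; rewrite e linear0].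
    rewrite p0; split=> -[t tz]; exists t => n /tz; rewrite iprodZE.
      by move=> e; apply: (@iZ_inj n); rewrite e linear0.
    by move=> ->; rewrite linear0.
  split=> [fz|[x <-]]; last exact: subvP.
  by exists (msub (submod_fin_supp Z) fz); rewrite msubK.
apply: (hfe_cokernel (@subv_inj _ _ _ (submod_fin_supp Z)) qsurj qK (hfe_dsum hfe_Z) hfe_prodZ).
by move=> x; apply: (subvP x).
Qed.

(** Choose for each [n] a map from [K] to [Z n] that does not extend, if there is one.
    Together they give a map from [K] to [Q].  Its lift to [V] extends to [R] because
    [V] is injective, and [dV] maps the extension back to [Q].  This extends the given
    maps modulo finite support, hence for [n] large as [K] is finitely generated. *)
Lemma ideal_extends (K : R^o -> Prop) (Ks : submod K) : fgm (subm Ks) ->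
  exists N, forall n, (N <= n)%N -> forall f : {linear subm Ks -> Z n},
    exists z, forall x, f x = (subv x : R) *: z.
Proof.
move=> fgK; pose ext n (f : {linear subm Ks -> Z n}) :=
  exists z, forall x, f x = (subv x : R) *: z.
have H n : exists f : {linear subm Ks -> Z n}, ext n f -> forall f', ext n f'.
  have [[f nf]|nf] := pselect (exists f, ~ ext n f); first by exists f.
  exists (\0 : {linear subm Ks -> Z n}) => _ f'; apply: contrapT => nf'.
  by apply: nf; exists f'.
pose f := tuplem (fun n => sval (cid (H n))).
have [q [qsurj qE]] := prodZ_to_Q; have [t tE] := Q_lift.
have [|h hE] := inj_factor (a := (subv : {linear subm Ks -> (R^o : lmodType R)}))
    (f := t \o (q \o f) : {linear subm Ks -> V}) injV.
  by move=> x x0; rewrite (_ : x = 0) ?linear0 //; apply: subv_inj; rewrite x0 linear0.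
have [c cE] : exists c : Q, subv c = dV (h (1 : R^o)) by apply/subvQ; apply: dVdV.
have [z zc] := qsurj c.
have zl : linear (fun x : subm Ks => (subv x : R) *: iprodZ z).
  by move=> a x y; rewrite linP scalerDl -scalerA.
have zlE x : mklin zl x = (subv x : R) *: iprodZ z by apply: mklinE.
have [|N NP] := fgm_unif_supp (t := (iprodZ \o f) \- mklin zl : {linear subm Ks -> W}) fgK.
  move=> x; apply/p0; rewrite /= zlE linearB linZ -!qE zc cE -linZ -linZ.
  rewrite -tE -[X in h X]/((subv x : R) * 1) mulr1 hE; exact: subrr.
exists N => n Nn f'; apply: (svalP (cid (H n))).
exists (z n) => x; apply: (@iZ_inj n); apply/subr0_eq.
have := NP x n Nn; rewrite /= zlE prodmD prodmN prodmZ !iprodZE linZ => <-.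
by rewrite /f tuplemE.
Qed.

Lemma Z_injective : noeth (R^o : lmodType R) -> artin (R^o : lmodType R) ->
  exists n, injective_module (Z n.+1).
Proof.
move=> noR arR; have [m [K [Ks KP]]] := finitely_many_simples arR.
have [N NP] : exists N, forall i (lt_im : (i < m)%N) (Ks : submod (K i)) n, (N <= n)%N ->
    forall f : {linear subm Ks -> Z n}, exists z, forall x, f x = (subv x : R) *: z.
  elim: (m) Ks => [|m' IH] Ks; first by exists 0%N.
  have [|N NP] := IH; first by move=> i lt_i; apply: Ks; apply: ltnW.
  have Kms := Ks m' (ltnSn m'); have [g gE] := noR _ Kms.
  have [N' N'P] := ideal_extends (subm_fgm Kms gE).
  exists (maxn N N') => i lt_i Kis n; rewrite geq_max => /andP[Nn N'n] f.
  move: lt_i; rewrite ltnS leq_eqVlt => /orP[/eqP im|lt_i]; last exact: NP lt_i _ _ Nn _.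
  by subst i; rewrite (Prop_irrelevance Kis Kms) in f *; apply: N'P.
exists N; apply: (@baer _ _ (fun L => exists i, (i < m)%N /\ forall a, L a <-> K i a)).
  move=> L Ls [i [lt_im LK]] f; have eLK : L = K i by apply/funext => a; apply/propext.
  by subst L; apply: NP lt_im _ _ (leqnSn N) f.
by move=> X S Ss nS; apply: KP.
Qed.

Lemma Z_split n : injective_module (Z n.+1) ->
  exists t : {linear Z n -> Y n.+1}, forall x, pZ n (t x) = x.
Proof.
move=> injZ; exact: split_injective_kernel injZ (@iZ_inj n.+1) (@pZ_surj n) (@pZK n).
Qed.

Lemma first_map_split : noeth (R^o : lmodType R) -> artin (R^o : lmodType R) ->
  exists t : {linear Y 0 -> Y 1}, forall y, dY 0 (t y) = y.
Proof.
move=> noR arR; have [n injZ] := Z_injective noR arR.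
have {n injZ} injZ1 : injective_module (Z 1).
  elim: n injZ => // n IH injZ; apply: IH; have [t tE] := Z_split injZ.
  exact: injective_retract (@injY n.+2) tE.
have [t tE] := Z_split injZ1; exists t => y.
by rewrite -pZE /= tE.
Qed.

End Periodic.

(** * The dual of a projective resolution *)

Section DualComplex.
Variables (k : comPzRingType) (A : algType k).
Local Notation Lam := (A^c^o : lmodType A^c).
Hypotheses (ark : artin k^o) (fgA : finitely_generated A).
Variables (M : lmodType A^c) (P : proj_resolution M) (E : lmodType k).
Hypothesis injE : injective_module E.
Hypothesis hom0 : forall (f : {linear M -> Lam}) x, f x = 0.
Hypothesis extM : forall n, hom_to_exact_at (res_diff P n.+1) (res_diff P n) Lam.

Let d n : {linear res_obj P n.+1 -> res_obj P n} := res_diff P n.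
Let Y n : lmodType A^c := dualm (res_obj P n) E.
Definition dual_diff n : {linear Y n.+1 -> Y n} := dual_map E (d n).

Lemma dual_diff_surj : surjective_map (dual_diff 0).
Proof.
move=> y; have [|f fE] := @inj_factor _ _ _ _ (precomp Lam (d 0%N)) (dval y) injE.
  move=> u u0; suff -> : u = 0 by rewrite linear0.
  have [||g gE] := @factor_surj _ _ _ _ (res_aug P) (hval u).
  - exact: res_aug_surj.
  - by move=> _ /(exact_ker (@res_aug_exact _ _ P))[x <-]; rewrite -precompE u0 hval0.
  by apply: hval_inj => x; rewrite -gE hom0 hval0.
exists (dmk f); apply: dval_inj => u; rewrite dual_mapE dmkK; exact: fE.
Qed.

Lemma dual_diff_dd n y : dual_diff n (dual_diff n.+1 y) = 0.
Proof.
apply: dval_inj => u; rewrite !dual_mapE dval0 (_ : precomp _ _ _ = 0) ?linear0 //.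
by apply: hval_inj => x; rewrite !precompE hval0 /d res_dd linear0.
Qed.

Lemma dual_diff_exact n : exact_at (dual_diff n.+1) (dual_diff n).
Proof.
move=> y; split=> [dy|[z <-]]; last exact: dual_diff_dd.
have [|f fE] := @inj_factor _ _ _ _ (precomp Lam (d n.+1)) (dval y) injE.
  move=> u u0; have [v vE] : exists v : {linear _ -> Lam}, hval u =1 v \o d n.
    by apply/extM => x; rewrite -precompE u0 hval0.
  have -> : u = precomp Lam (d n) (hmk v).
    by apply: hval_inj => x; rewrite precompE hmkK; apply: vE.
  by rewrite -dual_mapE -/(dual_diff n) dy dval0.
exists (dmk f); apply: dval_inj => u; rewrite dual_mapE dmkK; exact: fE.
Qed.

(** Hom (F, -) of the dual complex is the dual of Hom (P, F), which is exact in
    positive degrees when [F] is injective. *)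
Lemma dual_diff_fg_exact F : injective_module F -> fgm F ->
  forall n (g : {linear F -> Y n.+1}), (forall x, dual_diff n (g x) = 0) ->
  exists g' : {linear F -> Y n.+2}, forall x, dual_diff n.+1 (g' x) = g x.
Proof.
move=> injF fgF n g dg.
have [phi phiE] := hom_dual_surj ark fgA (@res_projective _ _ P n.+1) fgF g.
have phid : forall w, (phi \o precomp F (d n)) w = 0.
  apply: (hom_dual_inj (@res_projective _ _ P n) fgF) => x.
  by rewrite -dual_map_hom phiE; apply: dg.
have [|phi' phi'E] := @inj_factor _ _ _ _ (precomp F (d n.+1)) phi injE.
  move=> u u0; have [|v vE] := @inj_factor _ _ _ _ (d n) (hval u) injF.
    by move=> _ /(exact_ker (@res_exact _ _ P n))[x <-]; rewrite -precompE u0 hval0.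
  have -> : u = precomp F (d n) (hmk v).
    by apply: hval_inj => x; rewrite precompE hmkK vE.
  exact: phid.
exists (hom_dual phi') => x; rewrite dual_map_hom -phiE; apply: dval_inj => u.
by rewrite !hom_dualE /= phi'E.
Qed.

(** Applying Hom (F, -) to the split surjection gives a surjection, the dual of the
    map from Hom (P_0, F) to Hom (P_1, F); the latter kills Hom (M, F). *)
Lemma dual_split_hom0 (t : {linear Y 0 -> Y 1}) (F : lmodType A^c) (u : {linear M -> F})
    (phi : {linear homm (res_obj P 0) F -> E}) :
  (forall y, dual_diff 0 (t y) = y) -> fgm F ->
  phi (hmk (u \o res_aug P)) = 0.
Proof.
move=> tE fgF.
have [psi psiE] := hom_dual_surj ark fgA (@res_projective _ _ P 1) fgF (t \o hom_dual phi).
have H : forall w, (phi \- (psi \o precomp F (d 0%N))) w = 0.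
  apply: (hom_dual_inj (@res_projective _ _ P 0) fgF) => x.
  apply: dval_inj => v; rewrite hom_dualE dval0 /=.
  have := tE (hom_dual phi x).
  have -> : t (hom_dual phi x) = hom_dual psi x by rewrite psiE.
  rewrite /dual_diff dual_map_hom => /(congr1 (fun y : dualm _ E => dval y v)).
  by rewrite !hom_dualE /= => ->; rewrite subrr.
have := H (hmk (u \o res_aug P)); rewrite /= => /subr0_eq ->.
rewrite (_ : precomp _ _ _ = 0) ?linear0 //; apply: hval_inj => x.
by rewrite precompE hmkK hval0 /= res_augd linear0.
Qed.

End DualComplex.

Theorem corollary1p8 (k : comPzRingType) (A : algType k)
  (artinA : artin_algebra A) (vgA : virtually_gorenstein A)
  (M : lmodType A^c)
  (extM : forall n : nat, ext_vanishes n M A^c^o) :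
  forall x : M, x = 0.
Proof.
move=> x; apply: contrapT => x0; have [/artinianP ark fgA] := artinA.
have noL := noeth_Lam ark fgA; have arL := artin_Lam ark fgA.
have [P _] := extM 1%N.
have extP n : hom_to_exact_at (res_diff P n.+1) (res_diff P n) (A^c^o : lmodType A^c).
  exact: ext_any_resolution (extM n.+1).
have [F [u [injF fgF ux]]] := fg_injective_cogenerator_alg ark fgA x0.
pose u0 := hmk (u \o res_aug P : {linear res_obj P 0 -> F}).
have u0n : u0 <> 0.
  move=> e; have [y yx] := res_aug_surj P x; apply: ux.
  by have := hmkK (u \o res_aug P) y; rewrite -/u0 e hval0 /= yx => <-.
have [E [phi [injE _ phiu]]] := fg_injective_cogenerator ark u0n.
have injY n : injective_module (dualm (res_obj P n) E).
  exact: dualm_injective ark fgA _ _ (@res_projective _ _ P n) injE.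
have [V [p [s [dV [injV psK p0 dVE]]]]] := reduced_product_exists (dual_diff P E) noL injY.
have emb (N : lmodType A^c) := embed_dsum arL noL
  (fun (t : N) t0 => fg_injective_cogenerator_alg ark fgA t0).
have [t tE] := first_map_split injY (dual_diff_surj injE (extM 0%N))
  (dual_diff_exact injE extP) (dual_diff_fg_exact ark fgA injE) emb injV psK p0 dVE vgA
  noL arL.
exact: phiu (dual_split_hom0 ark fgA u phi tE fgF).
Qed.
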